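(* Let $V$ be $\mathbb{R}^{1,1}$ (with $\varsigma=-1$) or $\mathbb{R}^{0,2}$ (with $\varsigma=+1$), let $S=\mathsf{S}=\mathbb{R}^2$ be the irreducible real pinor module, let $B$ be either of the two admissible bilinears on $\mathsf{S}$ (distinguished by $\varsigma_B=\pm1$), let $\kappa$ be the associated Dirac current and $\mathfrak{s}$ the flat model superalgebra defined by $(V,S,\kappa)$. Then every normalised cocycle $\beta+\gamma\in\mathcal{H}^{2,2}$ is integrable. Consequently $\mathfrak{s}$ has a one-parameter family of filtered deformations $\widetilde{\mathfrak{s}}=\widetilde{\mathfrak{s}}_b$, $b\in\mathbb{R}$, on the underlying vector superspace of $\mathfrak{s}$, with brackets $$[L_*,s]=\tfrac12\Gamma_*s,\qquad [L_*,P_\mu]=-\varsigma\,\varepsilon_{\mu\nu}P^\nu,$$ together with, if $\varsigma_B=+1$, $$[P_\mu,P_\nu]=\varsigma\,4b^2\varepsilon_{\mu\nu}L_*,\qquad [P_\mu,s]=b\,\varepsilon_{\mu\nu}\Gamma^\nu s,\qquad [s,s]=\kappa_s^\mu P_\mu+\varsigma\,2b\,B(s,s)L_*,$$ or, if $\varsigma_B=-1$, $$[P_\mu,P_\nu]=4b^2\varepsilon_{\mu\nu}L_*,\qquad [P_\mu,s]=b\,\Gamma_\mu s,\qquad [s,s]=\kappa_s^\mu P_\mu-\varsigma\,2b\,B(s,\Gamma_*s)L_*,$$ for $s\in S$. If $b\neq0$, then $\widetilde{\mathfrak{s}}_b$ has no proper subalgebra with odd part equal to $S$. Moreover, for $b\neq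 0$, the even part $\widetilde{\mathfrak{s}}_{\overline0}$ is the isometry algebra of a maximally symmetric pseudo-Riemannian surface which is a homogeneous space for the metric Lie pair $(\widetilde{\mathfrak{s}}_{\overline0},\mathfrak{so}(V),\eta)$ (where $V\cong\widetilde{\mathfrak{s}}_{\overline 0}/\mathfrak{so}(V)$): in the Riemannian case $\varsigma=+1$ it is the hyperbolic plane of scalar curvature $-8b^2$ for either value of $\varsigma_B$; in the Lorentzian case $\varsigma=-1$ it is $dS_2$ with scalar curvature $8b^2$ if $\varsigma_B=+1$, and $AdS_2$ with scalar curvature $-8b^2$ if $\varsigma_B=-1$.
   Context: Clifford conventions. $(V,\eta)$ is one of: signature $(1,1)$, $V=\mathbb{R}^{1,1}$ with orthonormal basis $e_0,e_1$, $\eta_{00}=-1$, $\eta_{11}=+1$; or ''signature $(0,2)$'', $V=\mathbb{R}^{0,2}$ with orthonormal basis $e_1,e_2$ and $\eta$ positive-definite. Set $\varsigma=\det[\eta]$. The Clifford relation is $v\cdot v=+\eta(v,v)\mathbb{1}$. Let $\sigma_1=\begin{pmatrix}0&1\\1&0\end{pmatrix}$, $\sigma_3=\begin{pmatrix}1&0\\0&-1\end{pmatrix}$, $\Omega=\begin{pmatrix}0&1\\-1&0\end{pmatrix}$. The pinor module is $\mathsf{S}=\mathbb{R}^2$ with $e_\mu$ acting by $\Gamma_\mu$, where in signature $(1,1)$: $\Gamma_0=\Omega$, $\Gamma_1=\sigma_1$, $\Gamma_*=\Gamma_0\Gamma_1=\sigma_3$; in signature $(0,2)$: $\Gamma_1=\sigma_3$,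 $\Gamma_2=\sigma_1$, $\Gamma_*=\Gamma_1\Gamma_2=\Omega$. Indices are raised and lowered with $\eta$, repeated indices are summed; $\varepsilon_{\mu\nu}$ is the antisymmetric symbol with $\varepsilon_{01}=+1$ in signature $(1,1)$, $\varepsilon_{12}=+1$ in signature $(0,2)$; $\Gamma^{\mu\nu}=\Gamma^{[\mu}\Gamma^{\nu]}$. An element $A\in\mathfrak{so}(V)$ acts on $\mathsf{S}$ by $A\cdot s=\tfrac14A_{\mu\nu}\Gamma^{\mu\nu}s$ with $A_{\mu\nu}=\eta(e_\mu,Ae_\nu)$. Admissible bilinears. In signature $(1,1)$: $B(\epsilon,\epsilon')=\epsilon^{T}\sigma_1\epsilon'$ (symmetric, $\varsigma_B=+1$) and $B(\epsilon,\epsilon')=\epsilon^T\Omega\epsilon'$ (skew, $\varsigma_B=-1$). In signature $(0,2)$: $B(\epsilon,\epsilon')=\epsilon^T\epsilon'$ ($\varsigma_B=+1$) and $B(\epsilon,\epsilon')=\epsilon^T\Omega\epsilon'$ ($\varsigma_B=-1$). The associated Dirac current is the symmetric map $\kappa\colon\operatorname{Sym}^2\mathsf{S}\to V$ with $\eta(\kappa(\epsilon,\epsilon'),v)=B(\epsilon,v\cdot\epsilon')$; $\kappa_s=\kappa(s,s)$, with components $\kappa_s^\mu=B(s,\Gamma^\mu s)$. Flat model superalgebra. $\mathfrak{s}=\mathfrak{s}_{-2}\oplus\mathfrak{s}_{-1}\oplus\mathfrak{s}_0$ with $\mathfrak{s}_{-2}=V$, $\mathfrak{s}_{-1}=S$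 (odd), $\mathfrak{s}_0=\mathfrak{so}(V)$, with brackets $[A,A']=0$, $[A,v]=Av$, $[A,s]=A\cdot s$, $[v,w]=0$, $[v,s]=0$, $[s,s']=\kappa(s,s')$. A filtered deformation of $\mathfrak{s}$ is a filtered Lie superalgebra whose associated graded Lie superalgebra is $\mathfrak{s}$. $P_\mu$ denotes the basis element $e_\mu$ of $V=\mathfrak{s}_{-2}$, and $L_*$ denotes the generator of $\mathfrak{so}(V)$ acting on $\mathsf S$ as $\tfrac12\Gamma_*$, i.e. with $(L_* )_{\mu\nu}=\varsigma\varepsilon_{\mu\nu}$. Normalised cocycles and integrability. $\mathcal{H}^{2,2}$ is the space of pairs $\beta+\gamma$ with $\beta\in\operatorname{Hom}(V\otimes S,S)$, $\gamma\in\operatorname{Hom}(\operatorname{Sym}^2S,\mathfrak{so}(V))$ such that $2\kappa(s,\beta(v,s))+\gamma(s,s)v=0$ and $\beta(\kappa_s,s)+\gamma(s,s)\cdot s=0$ for all $s\in S$, $v\in V$. For $\beta+\gamma\in\mathcal{H}^{2,2}$ define $\Theta\colon V\otimes\operatorname{Sym}^2S\to\mathfrak{so}(V)$ by $\Theta(v,s,s)=2\gamma(s,\beta(v,s))$. Then $\beta+\gamma$ is integrable if (1) $\Theta$ annihilates $V\otimes\ker\kappa$, so that $\Theta=\theta\circ(\mathrm{Id}\otimes\kappa)$ for a (necessarily skew-symmetric) map $\theta\colon V\otimes V\to\mathfrak{so}(V)$, and (2) $\theta(v,w)\cdot s=\beta(v,\beta(w,s))-\beta(w,\beta(v,s))$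 for all $v,w\in V$, $s\in S$. An integrable $\beta+\gamma$ defines a filtered deformation of $\mathfrak{s}$ on the same vector superspace with brackets $[A,A']=0$, $[A,v]=Av$, $[A,s]=A\cdot s$, $[v,w]=\theta(v,w)$, $[v,s]=\beta(v,s)$, $[s,s]=\kappa_s+\gamma(s,s)$. *)

(* Defs.v *)
From HB Require Import structures.
From mathcomp Require Import all_boot all_order all_algebra.
From mathcomp Require Import all_classical all_reals all_analysis.

Set Implicit Arguments.
Unset Strict Implicit.
Unset Printing Implicit Defensive.

Import Order.TTheory GRing.Theory Num.Theory.
Import numFieldNormedType.Exports.

Local Open Scope classical_set_scope.
Local Open Scope ring_scope.

Definition bilinear_map (R : realType) (U V W : lmodType R)
    (f : U -> V -> W) : Prop :=
  (forall x, linear (f x)) /\ (forall y, linear (fun x => f x y)).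

(** * Lie superalgebras

    The superspace with even part [E] and odd part [O] is [E * O]; a parity is
    a boolean, [true] being odd. *)

Section LieSuperalgebra.
Variables (R : realType) (E O : vectType R).
Implicit Types (br : E * O -> E * O -> E * O) (U : {vspace E * O}).

Definition has_parity (a : bool) (x : E * O) : Prop :=
  if a then x.1 = 0 else x.2 = 0.

Definition lie_superalgebra br : Prop :=
  [/\ bilinear_map br,
      forall a a' x y, has_parity a x -> has_parity a' y ->
        has_parity (a (+) a') (br x y),
      forall a a' x y, has_parity a x -> has_parity a' y ->
        br x y = - (-1) ^+ (a && a') *: br y x
    & forall a a' x y z, has_parity a x -> has_parity a' y ->
        br x (br y z) = br (br x y) z + (-1) ^+ (a && a') *: br y (br x z)].

Definition subsuperalgebra br U : Prop :=
  (forall x, x \in U -> (x.1, 0) \in U /\ (0, x.2) \in U) /\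
  (forall x y, x \in U -> y \in U -> br x y \in U).

Definition even_bracket br (x y : E) : E := (br (x, 0) (y, 0)).1.

End LieSuperalgebra.

(** * Clifford conventions *)

Inductive signature := Sig11 | Sig02.

(* The admissible bilinear is symmetric for [Bplus], skew for [Bminus]. *)
Inductive bsign := Bplus | Bminus.

Section Clifford.
Variables (R : realType).

Definition mx2 (a b c d : R) : 'M[R]_2 :=
  \matrix_(i, j) if i == 0 then (if j == 0 then a else b)
                 else (if j == 0 then c else d).

Definition sigma1 := mx2 0 1 1 0.
Definition sigma3 := mx2 1 0 0 (-1).
Definition Omega := mx2 0 1 (-1) 0.

Variables (sig : signature) (sB : bsign).

(* V and S are both R^2, written as column vectors. The indices 0, 1 of 'I_2
   are the indices 0, 1 of R^{1,1}, and the indices 1, 2 of R^{0,2}. *)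
Local Notation V := 'cV[R]_2.
Local Notation S := 'cV[R]_2.

Definition eta : 'M[R]_2 :=
  match sig with Sig11 => mx2 (-1) 0 0 1 | Sig02 => 1%:M end.

Definition varsigma : R := \det eta.

Definition etab (v w : V) : R := (v^T *m eta *m w) 0 0.

(* [Omega] is the matrix of the antisymmetric symbol. *)
Definition eps (mu nu : 'I_2) : R := Omega mu nu.

Definition basis (mu : 'I_2) : V := delta_mx mu 0.

Definition Gam (mu : 'I_2) : 'M[R]_2 :=
  match sig with
  | Sig11 => if mu == 0 then Omega else sigma1
  | Sig02 => if mu == 0 then sigma3 else sigma1
  end.

Definition GamStar : 'M[R]_2 := Gam 0 *m Gam 1.

(* [raise T] is the family T^mu = eta^{mu nu} T_nu. *)
Definition raise (W : lmodType R) (T : 'I_2 -> W) (mu : 'I_2) : W :=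
  \sum_nu invmx eta mu nu *: T nu.

Definition Gam_up : 'I_2 -> 'M[R]_2 := raise Gam.

Definition Gam_up2 (mu nu : 'I_2) : 'M[R]_2 :=
  2^-1 *: (Gam_up mu *m Gam_up nu - Gam_up nu *m Gam_up mu).

(** so(V): the endomorphisms of V that are skew for eta *)

Definition skew_defect (A : 'M[R]_2) : 'M[R]_2 := A^T *m eta + eta *m A.

Lemma skew_defect_linear : linear skew_defect.
Proof.
move=> a A B; rewrite /skew_defect linearP mulmxDl mulmxDr.
by rewrite -scalemxAl -scalemxAr scalerDr addrACA.
Qed.

HB.instance Definition _ :=
  GRing.isLinear.Build R 'M[R]_2 'M[R]_2 _ skew_defect skew_defect_linear.

Definition so_space : {vspace 'M[R]_2} := lker (linfun skew_defect).

Definition so : vectType R := subvs_of so_space.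

Lemma mem_so A : (A \in so_space) = (A^T *m eta + eta *m A == 0).
Proof. by rewrite memv_ker lfunE. Qed.

Definition act_V (A : so) (v : V) : V := vsval A *m v.

Definition lower_so (A : so) (mu nu : 'I_2) : R :=
  etab (basis mu) (act_V A (basis nu)).

Definition act_S (A : so) (s : S) : S :=
  4^-1 *: \sum_mu \sum_nu lower_so A mu nu *: (Gam_up2 mu nu *m s).

Lemma tr_eta : eta^T = eta.
Proof.
rewrite /eta; case: sig; last by rewrite trmx1.
by apply/matrixP=> i j; rewrite !mxE; case: (i == 0); case: (j == 0).
Qed.

Lemma unit_eta : eta \in unitmx.
Proof.
rewrite /eta; case: sig; last exact: unitmx1.
rewrite unitmxE (expand_det_row _ 0) !big_ord_recl big_ord0 /cofactor !mxE /=.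
by rewrite !det_mx11 !mxE /= mul0r !addr0 expr0 !mul1r mulr1 unitrN1.
Qed.

Lemma tr_Omega : Omega^T = - Omega.
Proof.
apply/matrixP=> i j; rewrite !mxE.
by case: i => [[|[|]]] //= ?; case: j => [[|[|]]] //= ?; rewrite ?oppr0 ?opprK.
Qed.

Definition Lstar_mx : 'M[R]_2 :=
  varsigma *: (invmx eta *m \matrix_(mu, nu) eps mu nu).

Lemma Lstar_subproof : Lstar_mx \in so_space.
Proof.
have -> : Lstar_mx = varsigma *: (invmx eta *m Omega).
  by congr (_ *: (_ *m _)); apply/matrixP=> i j; rewrite mxE.
rewrite mem_so linearZ /= trmx_mul trmx_inv tr_eta tr_Omega.
rewrite -scalemxAl -scalemxAr mulmxKV ?unit_eta // mulmxA mulmxV ?unit_eta //.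
by rewrite mul1mx scalerN addNr.
Qed.

Definition Lstar : so := Subvs Lstar_subproof.

Lemma lower_so_Lstar mu nu : lower_so Lstar mu nu = varsigma * eps mu nu.
Proof.
rewrite /lower_so /etab /act_V /= /Lstar_mx /basis trmx_delta.
rewrite -scalemxAl -scalemxAr mxE; congr (_ * _).
rewrite -!mulmxA (mulmxA eta) mulmxV ?unit_eta // mul1mx mulmxA -rowE.
by rewrite -colE !mxE.
Qed.

(** * Dirac current, normalised cocycles and their deformations *)

Definition clifford (v : V) (s : S) : S := \sum_mu v mu 0 *: (Gam mu *m s).

Definition B_mx : 'M[R]_2 :=
  match sB, sig with
  | Bplus, Sig11 => sigma1
  | Bplus, Sig02 => 1%:M
  | Bminus, _ => Omega
  end.

Definition bil (s t : S) : R := (s^T *m B_mx *m t) 0 0.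

Definition kappa (s t : S) : V := \col_mu bil s (Gam_up mu *m t).

Lemma etab_kappa s t v : etab (kappa s t) v = bil s (clifford v t).
Proof.
pose c : V := \col_nu bil s (Gam nu *m t).
have -> : kappa s t = invmx eta *m c.
  apply/colP=> mu; rewrite !mxE /bil /Gam_up /raise mulmx_suml mulmx_sumr.
  rewrite summxE; apply: eq_bigr => nu _.
  by rewrite -scalemxAl -scalemxAr mxE [c nu 0]mxE.
rewrite /etab trmx_mul trmx_inv tr_eta mulmxKV ?unit_eta //.
rewrite /bil /clifford mulmx_sumr summxE mxE; apply: eq_bigr => nu _.
by rewrite -scalemxAr [c^T 0 nu]mxE [c nu 0]mxE [RHS]mxE mulrC.
Qed.

Definition normalised_cocycle (beta : V -> S -> S) (gamma : S -> S -> so) :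
    Prop :=
  [/\ bilinear_map beta,
      bilinear_map gamma /\ (forall s t, gamma s t = gamma t s),
      forall s v, 2 *: kappa s (beta v s) + act_V (gamma s s) v = 0
    & forall s, beta (kappa s s) s + act_S (gamma s s) s = 0].

(* The polarisation in s of v (x) s^2 |-> 2 gamma(s, beta(v, s)). *)
Definition Theta (beta : V -> S -> S) (gamma : S -> S -> so)
    (v : V) (s t : S) : so :=
  gamma s (beta v t) + gamma t (beta v s).

(* The elements of Sym^2 S are the finite sums of products s_i t_i. *)
Definition annihilates_ker_kappa (beta : V -> S -> S) (gamma : S -> S -> so) :
    Prop :=
  forall (v : V) (n : nat) (s t : 'I_n -> S),
    \sum_i kappa (s i) (t i) = 0 -> \sum_i Theta beta gamma v (s i) (t i) = 0.

Definition integrated_by (beta : V -> S -> S) (gamma : S -> S -> so)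
    (theta : V -> V -> so) : Prop :=
  [/\ bilinear_map theta,
      forall v s t, Theta beta gamma v s t = theta v (kappa s t)
    & forall v w s,
        act_S (theta v w) s = beta v (beta w s) - beta w (beta v s)].

Definition integrable_cocycle (beta : V -> S -> S) (gamma : S -> S -> so) :
    Prop :=
  annihilates_ker_kappa beta gamma /\
  exists theta, integrated_by beta gamma theta.

(** * The flat model superalgebra and its filtered deformations *)

Definition even_part : vectType R := (V * so)%type.
Definition superspace : vectType R := (even_part * S)%type.

Definition deformation (beta : V -> S -> S) (gamma : S -> S -> so)
    (theta : V -> V -> so) (x y : superspace) : superspace :=
  let: ((v, A), s) := x in
  let: ((w, A'), t) := y in
  ((act_V A w - act_V A' v + kappa s t, theta v w + gamma s t),
   act_S A t - act_S A' s + beta v t - beta w s).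

Definition flat_bracket : superspace -> superspace -> superspace :=
  deformation (fun _ _ => 0) (fun _ _ => 0) (fun _ _ => 0).

(* The component of degree d, where V, S and so(V) have degree -2, -1 and 0. *)
Definition gr_comp (d : int) (x : superspace) : superspace :=
  let: ((v, A), s) := x in
  if d == -2 then ((v, 0), 0)
  else if d == -1 then ((0, 0), s)
  else if d == 0 then ((0, A), 0)
  else 0.

Definition filt (d : int) (x : superspace) : Prop :=
  forall e : int, e < d -> gr_comp e x = 0.

(* [gr_comp d] maps [filt d] onto the degree-d part of the flat model with
   kernel [filt (d + 1)]; the last clause says that these maps identify the
   associated graded superalgebra with the flat model. *)
Definition filtered_deformation
    (br : superspace -> superspace -> superspace) : Prop :=
  [/\ lie_superalgebra br,
      forall i j x y, filt i x -> filt j y -> filt (i + j) (br x y)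
    & forall i j x y, filt i x -> filt j y ->
        gr_comp (i + j) (br x y) = flat_bracket (gr_comp i x) (gr_comp j y)].

Definition inV (v : V) : superspace := ((v, 0), 0).
Definition inS (s : S) : superspace := ((0, 0), s).
Definition inSo (A : so) : superspace := ((0, A), 0).

Definition P_ (mu : 'I_2) : superspace := inV (basis mu).
Definition P_up : 'I_2 -> superspace := raise P_.
Definition L_ : superspace := inSo Lstar.

Definition even_isotropy (x : even_part) : Prop := x.1 = 0.
Definition even_metric (x y : even_part) : R := etab x.1 y.1.

End Clifford.

Arguments basis {R} mu.
Arguments eps {R} mu nu.
Arguments varsigma {R} sig.
Arguments Gam {R} sig mu.
Arguments Gam_up {R} sig mu.
Arguments GamStar {R} sig.
Arguments inV {R} sig v.
Arguments inS {R sig} s.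
Arguments P_ {R} sig mu.
Arguments P_up {R} sig mu.
Arguments L_ {R} sig.
Arguments even_isotropy {R sig} x.
Arguments even_metric {R sig} x y.
Arguments normalised_cocycle {R} sig sB beta gamma.
Arguments integrable_cocycle {R} sig sB beta gamma.
Arguments integrated_by {R} sig sB beta gamma theta.
Arguments deformation {R} sig sB beta gamma theta x y.
Arguments flat_bracket {R} sig sB x y.
Arguments filtered_deformation {R} sig sB br.

(** * Metric Lie pairs *)

Section MetricLiePair.
Variables (R : realType) (g : vectType R).
Variables (br : g -> g -> g) (h : g -> Prop) (q : g -> g -> R).

(* The inner product on g/h is given by its pullback q to g, a symmetric
   bilinear form whose radical is h. *)
Definition metric_lie_pair : Prop :=
  [/\ h 0 /\ (forall a x y, h x -> h y -> h (a *: x + y)),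
      forall x y, h x -> h y -> h (br x y),
      (forall x y, q x y = q y x) /\
        (forall a x y z, q (a *: x + y) z = a * q x z + q y z),
      forall x, h x <-> (forall y, q x y = 0)
    & forall a x y, h a -> q (br a x) y + q x (br a y) = 0].

End MetricLiePair.

(** * Pseudo-Riemannian surfaces

    A surface is a subset of R^3, with the metric induced by an inner product
    (of any signature) on R^3. It is described through a global
    parametrisation: a smooth map from R^2 onto the surface, possibly periodic,
    that pulls the inner product back to a nondegenerate metric (so that it is
    an immersion). A vector field on the surface is given by its components,
    which are functions on R^2, in the coordinate frame. *)

Section Surface.
Variables (R : realType).

Local Notation plane := 'rV[R]_2.
Local Notation space := 'rV[R]_3.

Fixpoint Ck (U W : normedModType R) (k : nat) (f : U -> W) : Prop :=
  match k with
  | 0 => continuous f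
  | k'.+1 => (forall x, differentiable f x) /\
             (forall v, Ck k' (fun x => 'D_v f x))
  end.

Definition smooth (U W : normedModType R) (f : U -> W) : Prop :=
  forall k, Ck k f.

Definition pd (i : 'I_2) (f : plane -> R) (p : plane) : R :=
  'D_(delta_mx 0 i) f p.

Section Metric.
Variable G : plane -> 'M[R]_2.

Definition metric_at (p u w : plane) : R := (u *m G p *m w^T) 0 0.

Definition christoffel (k i j : 'I_2) (p : plane) : R :=
  2^-1 * \sum_l invmx (G p) k l *
    (pd i (fun x => G x j l) p + pd j (fun x => G x i l) p
     - pd l (fun x => G x i j) p).

(* The sign is the one for which round spheres have positive curvature. *)
Definition ricci (j k : 'I_2) (p : plane) : R :=
  \sum_i (pd i (christoffel i j k) p - pd j (christoffel i i k) p
    + \sum_l (christoffel i i l p * christoffel l j k p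
              - christoffel i j l p * christoffel l i k p)).

Definition scalar_curvature (p : plane) : R :=
  \sum_j \sum_k invmx (G p) j k * ricci j k p.

Definition lie_derivative (X : plane -> plane) (i j : 'I_2) (p : plane) : R :=
  \sum_k (X p 0 k * pd k (fun x => G x i j) p
          + G p k j * pd i (fun x => X x 0 k) p
          + G p i k * pd j (fun x => X x 0 k) p).

End Metric.

Definition field_bracket (X Y : plane -> plane) (p : plane) : plane :=
  'D_(X p) Y p - 'D_(Y p) X p.

Record surface := Surface {
  ambient : 'M[R]_3;
  points : set space
}.

Definition induced_metric (M : surface) (sigma : plane -> space) (p : plane) :
    'M[R]_2 :=
  \matrix_(i, j) (('D_(delta_mx 0 i) sigma p : space) *m ambient M
                  *m ('D_(delta_mx 0 j) sigma p : space)^T) 0 0.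

Definition parametrises (M : surface) (sigma : plane -> space) : Prop :=
  [/\ smooth sigma, range sigma = points M
    & forall p, induced_metric M sigma p \in unitmx].

Variables (M : surface) (sigma : plane -> space).

Definition vector_field (X : plane -> plane) : Prop :=
  smooth X /\
  forall p p', sigma p = sigma p' -> 'D_(X p) sigma p = 'D_(X p') sigma p'.

Definition killing (X : plane -> plane) : Prop :=
  vector_field X /\
  forall i j p, lie_derivative (induced_metric M sigma) X i j p = 0.

(* The Killing fields form a space of the maximal dimension n(n+1)/2 = 3. *)
Definition maximally_symmetric : Prop :=
  exists K : 'I_3 -> plane -> plane,
    [/\ forall i, killing (K i),
        forall X, killing X ->
          exists c : 'I_3 -> R, forall p, X p = \sum_i c i *: K i p
      & forall c : 'I_3 -> R,
          (forall p, \sum_i c i *: K i p = 0) -> forall i, c i = 0].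

Definition integral_curve (X : plane -> plane) (gam : R -> space) : Prop :=
  forall t : R, exists2 p, sigma p = gam t
    & is_derive t (1 : R) gam ('D_(X p) sigma p).

Section Action.
Variables (g : vectType R) (br : g -> g -> g) (Phi : g -> plane -> plane).

Definition isometric_action : Prop :=
  [/\ forall a x y p, Phi (a *: x + y) p = a *: Phi x p + Phi y p,
      forall x y p, Phi (br x y) p = field_bracket (Phi x) (Phi y) p
    & forall x, killing (Phi x)].

Definition isometry_algebra_iso : Prop :=
  [/\ isometric_action,
      forall x, (forall p, Phi x p = 0) -> x = 0
    & forall X, killing X -> exists x, forall p, Phi x p = X p].

Definition complete_action : Prop :=
  forall x o, points M o ->
    exists2 gam : R -> space, gam 0 = o & integral_curve (Phi x) gam.

Inductive same_orbit (o : space) : space -> Prop :=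
  | same_orbit_refl : same_orbit o o
  | same_orbit_flow x gam t : integral_curve (Phi x) gam ->
      same_orbit o (gam 0) -> same_orbit o (gam t).

(* A complete action of a finite-dimensional Lie algebra is the derivative of
   an action of its simply connected Lie group, whose orbits are the classes
   of [same_orbit]. *)
Definition homogeneous_space (h : g -> Prop) (q : g -> g -> R) : Prop :=
  [/\ isometric_action,
      complete_action,
      forall o o', points M o -> points M o' -> same_orbit o o'
    & exists p0 : plane,
        (forall x, h x <-> Phi x p0 = 0) /\
        (forall x y,
          q x y = metric_at (induced_metric M sigma) p0 (Phi x p0) (Phi y p0))].

End Action.
End Surface.

(** * The model surfaces: quadrics of radius r in R^{1,2} and R^{2,1} *)

Section Models.
Variables (R : realType).

Definition diag3 (a b c : R) : 'M[R]_3 := diag_mx (\row_i [:: a; b; c]`_i).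

Definition sqnorm (K : 'M[R]_3) (x : 'rV[R]_3) : R := (x *m K *m x^T) 0 0.

Definition hyperbolic_plane (r : R) : surface R :=
  let K := diag3 (-1) 1 1 in
  Surface K [set x | sqnorm K x = - r ^+ 2 /\ 0 < x 0 0].

Definition de_sitter (r : R) : surface R :=
  let K := diag3 (-1) 1 1 in Surface K [set x | sqnorm K x = r ^+ 2].

Definition anti_de_sitter (r : R) : surface R :=
  let K := diag3 (-1) (-1) 1 in Surface K [set x | sqnorm K x = - r ^+ 2].

(* The Lie algebra [g] is the isometry algebra of [M], which is maximally
   symmetric, has scalar curvature [k], and is a homogeneous space for the
   metric Lie pair [(g, h, q)]. *)
Definition isometry_algebra_of_symmetric_surface (g : vectType R)
    (br : g -> g -> g) (h : g -> Prop) (q : g -> g -> R)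
    (M : surface R) (k : R) : Prop :=
  exists sigma : 'rV[R]_2 -> 'rV[R]_3,
    [/\ parametrises M sigma,
        maximally_symmetric M sigma,
        forall p, scalar_curvature (induced_metric M sigma) p = k
      & exists Phi : g -> 'rV[R]_2 -> 'rV[R]_2,
          isometry_algebra_iso M sigma br Phi /\
          homogeneous_space M sigma br Phi h q].

End Models.

(* Main.v *)
(** Since so(V) is one-dimensional, a normalised cocycle is given by eleven
    coordinates; the first cocycle condition is a linear system whose solutions
    form the line through the family of the statement, and all further algebraic
    claims are polynomial identities in coordinates. Pairs of odd elements
    bracket onto the even part when b is nonzero, because Sym^2 S and V + so(V)
    are both three-dimensional and the bracket is then an isomorphism.

    The three surfaces are the images of one map
      (t, u) |-> r (cosh t C(u), cosh t S(u), sinh t),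
    up to the order of the coordinates, with (C, S) = (cosh, sinh) for the
    hyperbolic plane and (cos, sin) for dS_2 and AdS_2. Their metrics are
    r^2 e1 (dt^2 + e cosh^2 t du^2) with C' = e S and an overall sign e1, of
    scalar curvature -2 e1 / r^2; hence r = 1 / |2b|. Killing fields are the
    restrictions of infinitesimal isometries of the ambient space, which are
    matrices N with N^3 proportional to N, so their flows are explicit. *)

Require Import Defs.
From HB Require Import structures.
From mathcomp Require Import all_boot all_order all_algebra.
From mathcomp Require Import all_classical all_reals all_analysis.
From mathcomp Require Import ring lra zify.

Set Implicit Arguments.
Unset Strict Implicit.
Unset Printing Implicit Defensive.

Import Order.TTheory GRing.Theory Num.Theory.
Import numFieldNormedType.Exports.

Local Open Scope classical_set_scope.
Local Open Scope ring_scope.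

(** * Coordinates *)

(** The coefficient of L_* in [P_0, P_1] decides the surface. In the Riemannian case it is 4 b^2 for
    either B; in the Lorentzian case it is -4 b^2 for the symmetric B and 4 b^2 for the skew one.
    Exchanging P_0 and P_1 reverses both this sign and the metric, and correspondingly dS_2 and
    AdS_2 are one parametrised quadric with opposite overall signs e1. Two signs therefore cover all
    four cases.

    On the analytic side the obstacle is that the parametrisation is periodic when (C, S) is
    circular, and that general flows are not explicit in (t, u). The fields are therefore pushed to
    the ambient space, where they become linear: their value then visibly depends on the point of
    the surface alone, and their flow lines are exp(sN) applied to a point, with parameters
    recovered afterwards because the parametrisation is onto. That these fields exhaust the Killing
    fields is proved in the plane instead, by integrating the Killing equations along coordinate
    lines. *)

Lemma sum2 (W : nmodType) (F : 'I_2 -> W) : \sum_i F i = F 0 + F 1.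
Proof.
by rewrite !big_ord_recl big_ord0 addr0; congr (_ + F _); apply/val_inj.
Qed.

Lemma sum3 (W : nmodType) (F : 'I_3 -> W) : \sum_i F i = F 0 + F 1 + F 2.
Proof.
rewrite !big_ord_recl big_ord0 addr0 addrA.
by congr (_ + F _ + F _); apply/val_inj.
Qed.

(** An eliminator that leaves the literals [0] and [1], on which the entry lemmas below can
    rewrite. *)
Lemma ord2P (P : 'I_2 -> Prop) : P 0 -> P 1 -> forall i, P i.
Proof.
move=> P0 P1 [[|[|//]] i]; [move: P0|move: P1]; congr P; exact/val_inj.
Qed.

Lemma col2P (R : realType) (v w : 'cV[R]_2) :
  v 0 0 = w 0 0 -> v 1 0 = w 1 0 -> v = w.
Proof.
move=> h0 h1; apply/matrixP=> i j; rewrite ord1.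
by elim/ord2P: i.
Qed.

Section Algebra.
Variable R : realType.
Implicit Types (sig : signature) (sB : bsign) (b : R).

Section Entries.
Variables (m n : nat).
Implicit Types A B : 'M[R]_(m, n).

Lemma addmxE A B i j : (A + B) i j = A i j + B i j. Proof. exact: mxE. Qed.
Lemma scalemxE k A i j : (k *: A) i j = k * A i j. Proof. exact: mxE. Qed.
Lemma oppmxE A i j : (- A) i j = - A i j. Proof. exact: mxE. Qed.
Lemma mx0E i j : (0 : 'M[R]_(m, n)) i j = 0. Proof. exact: mxE. Qed.

Definition entryE := (addmxE, scalemxE, oppmxE, mx0E).
End Entries.

Lemma mx2E (a b c d : R) :
  (mx2 a b c d 0 0 = a) * (mx2 a b c d 0 1 = b) * (mx2 a b c d 1 0 = c) *
  (mx2 a b c d 1 1 = d).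
Proof. by rewrite !mxE. Qed.

Lemma mx2M (a b c d : R) (s : 'cV[R]_2) :
  ((mx2 a b c d *m s) 0 0 = a * s 0 0 + b * s 1 0) *
  ((mx2 a b c d *m s) 1 0 = c * s 0 0 + d * s 1 0).
Proof. by split; rewrite mxE sum2 !mxE. Qed.

Lemma mx2_mul (a b c d a' b' c' d' : R) :
  mx2 a b c d *m mx2 a' b' c' d' =
  mx2 (a * a' + b * c') (a * b' + b * d') (c * a' + d * c') (c * b' + d * d').
Proof.
by apply/matrixP=> i j; elim/ord2P: i; elim/ord2P: j; rewrite mxE sum2 !mxE.
Qed.

Lemma mx2_scale (k a b c d : R) :
  k *: mx2 a b c d = mx2 (k * a) (k * b) (k * c) (k * d).
Proof.
by apply/matrixP=> i j; elim/ord2P: i; elim/ord2P: j; rewrite !mxE.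
Qed.

Lemma mx2_id : 1%:M = mx2 1 0 0 1 :> 'M[R]_2.
Proof. by apply/matrixP=> i j; elim/ord2P: i; elim/ord2P: j; rewrite !mxE. Qed.

(** The value of the determinant [varsigma], in a form that reduces to a numeral once [sig] is
    known. *)
Definition sg sig : R := if sig is Sig11 then -1 else 1.

Lemma sgM sig : sg sig * sg sig = 1.
Proof. by case: sig; rewrite /sg ?mulrNN mulr1. Qed.

Lemma etaE sig : Defs.eta R sig = mx2 (sg sig) 0 0 1.
Proof. by case: sig; rewrite /Defs.eta // mx2_id. Qed.

Lemma varsigmaE sig : varsigma sig = sg sig.
Proof.
rewrite /varsigma etaE (expand_det_row _ 0) sum2 /cofactor !det_mx11 !mxE /=.
by rewrite mul0r addr0 expr0 mul1r mulr1.
Qed.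

Lemma invmx_eta sig : invmx (Defs.eta R sig) = Defs.eta R sig.
Proof.
have h : Defs.eta R sig *m Defs.eta R sig = 1%:M.
  by rewrite etaE mx2_mul mx2_id sgM !(mulr0, mul0r, mulr1, addr0, add0r).
by rewrite -[LHS]mulmx1 -h mulKmx // unit_eta.
Qed.

Lemma raiseE sig (W : lmodType R) (T : 'I_2 -> W) :
  (raise sig T 0 = sg sig *: T 0) * (raise sig T 1 = T 1).
Proof.
by split; rewrite /raise invmx_eta sum2 etaE !mxE /= scale0r ?addr0 ?add0r
  ?scale1r.
Qed.

Lemma Lstar_mxE sig : Lstar_mx R sig = mx2 0 1 (- sg sig) 0.
Proof.
rewrite /Lstar_mx invmx_eta varsigmaE etaE.
have -> : \matrix_(mu, nu) eps mu nu = mx2 0 1 (-1) 0 :> 'M[R]_2.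
  by apply/matrixP=> i j; rewrite mxE.
rewrite mx2_mul mx2_scale !(mulr0, mul0r, mulr1, addr0, add0r, mulr1) sgM.
by rewrite mul1r mulrN1.
Qed.

(** The coordinate along [Lstar], whose upper right entry is 1 in both signatures. *)
Definition so_coord sig (A : so R sig) : R := vsval A 0 1.

Lemma so_coord_lin sig k (A A' : so R sig) : so_coord (k *: A + A') = k * so_coord A + so_coord A'.
Proof. by rewrite /so_coord linearP !mxE. Qed.

Lemma so_coord0 sig : so_coord (0 : so R sig) = 0.
Proof. by rewrite /so_coord linear0 mxE. Qed.

Lemma so_coordD sig (A A' : so R sig) : so_coord (A + A') = so_coord A + so_coord A'.
Proof. by rewrite /so_coord linearD !mxE. Qed.

Lemma so_coordZ sig k (A : so R sig) : so_coord (k *: A) = k * so_coord A.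
Proof. by rewrite /so_coord linearZ !mxE. Qed.

Lemma so_coordN sig (A : so R sig) : so_coord (- A) = - so_coord A.
Proof. by rewrite /so_coord linearN !mxE. Qed.

Lemma so_coord_Lstar sig : so_coord (Lstar R sig) = 1.
Proof. by rewrite /so_coord /= Lstar_mxE mxE. Qed.

(** Skewness for eta = diag(s, 1) kills the diagonal of A and forces A_10 = - s A_01, so so(V) is a
    line. *)
Lemma vsval_so sig (A : so R sig) : vsval A = so_coord A *: Lstar_mx R sig.
Proof.
have /eqP/matrixP h : (vsval A)^T *m Defs.eta R sig + Defs.eta R sig *m vsval A == 0.
  by rewrite -mem_so; exact: subvsP.
have := (h 0 0, h 0 1, h 1 1); rewrite /so_coord Lstar_mxE mx2_scale etaE.
rewrite !mxE !sum2 !mxE /= => -[[h1 h2] h3].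
have es := sgM sig.
have sg0 : sg sig != 0 by apply/eqP => s0; move: es; rewrite s0 mul0r => /eqP;
  rewrite eq_sym oner_eq0.
apply/matrixP=> i j; elim/ord2P: i; elim/ord2P: j; rewrite !mxE /=.
- apply: (mulfI sg0); lra.
- by rewrite mulr1.
- lra.
- lra.
Qed.

Lemma so_coordE sig (A : so R sig) : A = so_coord A *: Lstar R sig.
Proof. by apply/val_inj; rewrite /= vsval_so linearZ. Qed.

Lemma so_inj sig (A A' : so R sig) : so_coord A = so_coord A' -> A = A'.
Proof. by move=> h; rewrite (so_coordE A) (so_coordE A') h. Qed.

Lemma act_VE sig (A : so R sig) v :
  (act_V A v 0 0 = so_coord A * v 1 0) * (act_V A v 1 0 = - sg sig * so_coord A * v 0 0).
Proof. by split; rewrite /act_V vsval_so Lstar_mxE mx2_scale mx2M; ring. Qed.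

Lemma GamE sig : (Gam sig 0 = if sig is Sig11 then mx2 0 1 (-1) 0
                              else mx2 1 0 0 (-1) :> 'M[R]_2) *
  (Gam sig 1 = mx2 0 1 1 0 :> 'M[R]_2).
Proof. by case: sig. Qed.

Lemma Gam_upE sig : (Gam_up sig 0 = if sig is Sig11 then mx2 0 (-1) 1 0
                              else mx2 1 0 0 (-1) :> 'M[R]_2) *
  (Gam_up sig 1 = mx2 0 1 1 0 :> 'M[R]_2).
Proof.
rewrite /Gam_up !raiseE !GamE; split => //.
by case: sig; rewrite mx2_scale; congr mx2; rewrite /sg; ring.
Qed.

Lemma GamStarE sig : GamStar sig = if sig is Sig11 then mx2 1 0 0 (-1)
   else mx2 0 1 (-1) 0 :> 'M[R]_2.
Proof.
by rewrite /GamStar; case: sig; rewrite !GamE mx2_mul; congr mx2; ring.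
Qed.

Lemma Gam_up2E sig :
  (Gam_up2 R sig 0 0 = 0) * (Gam_up2 R sig 1 1 = 0) *
  (Gam_up2 R sig 0 1 = sg sig *: GamStar sig) *
  (Gam_up2 R sig 1 0 = - sg sig *: GamStar sig).
Proof.
rewrite /Gam_up2; split; [split; [by split; rewrite subrr scaler0|]|];
 rewrite GamStarE !Gam_upE; case: sig => /=; rewrite !mx2_mul;
 apply/matrixP=> i j; elim/ord2P: i; elim/ord2P: j; rewrite !mxE /=; by field.
Qed.

Lemma lower_soE sig (A : so R sig) mu nu :
  lower_so A mu nu = so_coord A * (sg sig * eps mu nu).
Proof.
rewrite -varsigmaE -lower_so_Lstar /lower_so /act_V vsval_so.
by rewrite /= /etab -scalemxAl -scalemxAr mxE.
Qed.

Lemma act_SE sig (A : so R sig) s :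
  act_S A s = (so_coord A / 2) *: (GamStar sig *m s).
Proof.
rewrite /act_S !sum2 !lower_soE !Gam_up2E !mul0mx !scaler0 add0r addr0.
rewrite -!scalemxAl !scalerA -!scalerDl !scalerA; congr (_ *: _).
rewrite /eps /Omega !mxE /=.
have es := sgM sig.
transitivity (so_coord A / 2 * (sg sig * sg sig)); [by field|by rewrite es mulr1].
Qed.

End Algebra.

(** The components of the Dirac current as polynomials in the coordinates of two spinors, free of
    matrices so that the decision procedures see plain scalars. *)
Definition kap0 (R : pzRingType) sig sB (s0 s1 t0 t1 : R) : R := match sB, sig with
   | Bminus, Sig11 => s0 * t0 + s1 * t1
   | Bminus, Sig02 => - (s0 * t1 + s1 * t0)
   | Bplus, _ => s0 * t0 - s1 * t1
   end.
Definition kap1 (R : pzRingType) sig sB (s0 s1 t0 t1 : R) : R := match sB, sig with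
   | Bplus, Sig11 => s0 * t0 + s1 * t1
   | Bplus, Sig02 => s0 * t1 + s1 * t0
   | Bminus, _ => s0 * t0 - s1 * t1
   end.

(** Here s = (x, y) and v = (z, u). The [a]'s and [c]'s are the two components of beta on pairs of
    basis vectors, and the [g]'s are the entries of the quadratic form gamma(s, s) in the coordinate
    along [Lstar]. *)
Lemma cocycle_solve (R : realFieldType) sig sB (a0 a1 a2 a3 c0 c1 c2 c3 g0 g1 g2 : R)
  (b0 := fun x y z u => z * (x * a0 + y * a1) + u * (x * a2 + y * a3))
  (b1 := fun x y z u => z * (x * c0 + y * c1) + u * (x * c2 + y * c3))
  (l := fun x y => x * (x * g0 + y * g1) + y * (x * g1 + y * g2)) :
  (forall x y z u, 2 * kap0 sig sB x y (b0 x y z u) (b1 x y z u) + l x y * u = 0) ->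
  (forall x y z u, 2 * kap1 sig sB x y (b0 x y z u) (b1 x y z u)
     - (if sig is Sig11 then -1 else 1) * l x y * z = 0) ->
  let b := match sB, sig with
    | Bplus, _ => c0
    | Bminus, Sig11 => a1
    | Bminus, Sig02 => a0
    end in
  (if sig is Sig11 then [/\ g0 = 0, g1 = - 2 * b & g2 = 0]
   else [/\ g0 = 2 * b, g1 = 0 & g2 = 2 * b]) /\
  match sB, sig with
  | Bplus, Sig11 => [/\ a0 = 0, a1 = b, a2 = 0 & a3 = b] /\
                    [/\ c0 = b, c1 = 0, c2 = - b & c3 = 0]
  | Bplus, Sig02 => [/\ a0 = 0, a1 = b, a2 = - b & a3 = 0] /\
                    [/\ c0 = b, c1 = 0, c2 = 0 & c3 = b]
  | Bminus, Sig11 => [/\ a0 = 0, a1 = b, a2 = 0 & a3 = b] /\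
                    [/\ c0 = - b, c1 = 0, c2 = b & c3 = 0]
  | Bminus, Sig02 => [/\ a0 = b, a1 = 0, a2 = 0 & a3 = b] /\
                    [/\ c0 = 0, c1 = - b, c2 = b & c3 = 0]
  end.
Proof.
rewrite /b0 /b1 /l {b0 b1 l} => E1 E2.
(* The conditions are linear in v and quadratic in s, so v in the basis and s among (1,0), (0,1),
   (1,1) exhaust them: twelve linear equations in eleven unknowns. *)
move: (E1 1 0 1 0) (E1 1 0 0 1) (E1 0 1 1 0) (E1 0 1 0 1) (E1 1 1 1 0)
    (E1 1 1 0 1)  (E2 1 0 1 0) (E2 1 0 0 1) (E2 0 1 1 0) (E2 0 1 0 1) (E2 1 1 1 0)
    (E2 1 1 0 1).
rewrite /kap0 /kap1 ?(mulr0, mul0r, mulr1, mul1r, addr0, add0r).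
case: sB sig {E1 E2}; case.
all: (move=> e1 e2 e3 e4 e5 e6 e7 e8 e9 e10 e11 e12).
all: (split; [|split]; split; lra).
Qed.

(** * Normalised cocycles *)

Lemma linear0_fun (R : realType) (U W : lmodType R) (f : U -> W) :
  linear f -> f 0 = 0.
Proof.
by move=> fl; have := fl (-1) 0 0; rewrite scaler0 addr0 scaleN1r addNr.
Qed.

Section Cocycles.
Variables (R : realType) (sig : signature) (sB : bsign).
Implicit Types (b : R) (v w s t : 'cV[R]_2).

Definition vec (x y : R) : 'cV[R]_2 := \col_i (if i == 0 then x else y).

Lemma bilE s t : bil sig sB s t =
  match sB, sig with
  | Bplus, Sig11 => s 0 0 * t 1 0 + s 1 0 * t 0 0
  | Bplus, Sig02 => s 0 0 * t 0 0 + s 1 0 * t 1 0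
  | Bminus, _ => s 0 0 * t 1 0 - s 1 0 * t 0 0
  end.
Proof.
rewrite /bil -mulmxA mxE sum2 ![s^T _ _]mxE /B_mx.
by case: sB; case: sig; rewrite ?mx2_id !mx2M; ring.
Qed.

Lemma kappaE s t :
  (kappa sig sB s t 0 0 = match sB, sig with
   | Bminus, Sig11 => s 0 0 * t 0 0 + s 1 0 * t 1 0
   | Bminus, Sig02 => - (s 0 0 * t 1 0 + s 1 0 * t 0 0)
   | Bplus, _ => s 0 0 * t 0 0 - s 1 0 * t 1 0
   end) *
  (kappa sig sB s t 1 0 = match sB, sig with
   | Bplus, Sig11 => s 0 0 * t 0 0 + s 1 0 * t 1 0
   | Bplus, Sig02 => s 0 0 * t 1 0 + s 1 0 * t 0 0
   | Bminus, _ => s 0 0 * t 0 0 - s 1 0 * t 1 0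
   end).
Proof.
rewrite !mxE !bilE !Gam_upE.
by case: sB; case: sig; rewrite !mx2M; split; ring.
Qed.

Lemma act_Sc (A : so R sig) s :
  (act_S A s 0 0 = so_coord A / 2 * (if sig is Sig11 then s 0 0 else s 1 0)) *
  (act_S A s 1 0 = so_coord A / 2 * (if sig is Sig11 then - s 1 0 else - s 0 0)).
Proof.
rewrite act_SE !mxE !GamStarE.
by case: sig A => A; rewrite ?sum2 ?mxE /=; split; ring.
Qed.

Definition beta_mx (mu : 'I_2) : 'M[R]_2 :=
  if sB is Bplus then \sum_nu eps mu nu *: Gam_up sig nu else Gam sig mu.

Definition beta_fam b v s : 'cV[R]_2 := \sum_mu v mu 0 *: (b *: (beta_mx mu *m s)).

Definition gamma_fam b s t : so R sig :=
  (if sB is Bplus then varsigma sig * 2 * b * bil sig sB s t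
   else - (varsigma sig * 2 * b * bil sig sB s (GamStar sig *m t)))
  *: Lstar R sig.

Definition theta_fam b v w : so R sig :=
  ((if sB is Bplus then varsigma sig else 1) * (4 * b ^+ 2)
    * (v 0 0 * w 1 0 - v 1 0 * w 0 0)) *: Lstar R sig.

Lemma beta_mxE :
  (beta_mx 0 = match sB, sig with
               | Bplus, _ => mx2 0 1 1 0
               | Bminus, Sig11 => mx2 0 1 (-1) 0
               | Bminus, Sig02 => mx2 1 0 0 (-1)
               end) *
  (beta_mx 1 = match sB, sig with
               | Bplus, Sig11 => mx2 0 1 (-1) 0
               | Bplus, Sig02 => mx2 (-1) 0 0 1
               | Bminus, _ => mx2 0 1 1 0
               end).
Proof.
rewrite /beta_mx !sum2 !Gam_upE !GamE.
case: sB; case: sig; rewrite ?mx2_scale; split => //; apply/matrixP => i j;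
  elim/ord2P: i; elim/ord2P: j; rewrite /eps !mxE /=; ring.
Qed.

Lemma beta_famE b v s :
  (beta_fam b v s 0 0 = b * match sB, sig with
   | Bplus, Sig11 => v 0 0 * s 1 0 + v 1 0 * s 1 0
   | Bplus, Sig02 => v 0 0 * s 1 0 - v 1 0 * s 0 0
   | Bminus, Sig11 => v 0 0 * s 1 0 + v 1 0 * s 1 0
   | Bminus, Sig02 => v 0 0 * s 0 0 + v 1 0 * s 1 0
   end) *
  (beta_fam b v s 1 0 = b * match sB, sig with
   | Bplus, Sig11 => v 0 0 * s 0 0 - v 1 0 * s 0 0
   | Bplus, Sig02 => v 0 0 * s 0 0 + v 1 0 * s 1 0
   | Bminus, Sig11 => - v 0 0 * s 0 0 + v 1 0 * s 0 0
   | Bminus, Sig02 => - v 0 0 * s 1 0 + v 1 0 * s 0 0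
   end).
Proof.
rewrite /beta_fam sum2 !beta_mxE.
by case: sB; case: sig; rewrite !entryE !mx2M; split; ring.
Qed.

(** For the skew B, the form B(s, Gamma_* t) is, up to sign, the symmetric admissible form, so both
    formulas for gamma coincide in coordinates. *)
Lemma gamma_famE b s t : so_coord (gamma_fam b s t) =
  2 * b * (if sig is Sig11 then - (s 0 0 * t 1 0 + s 1 0 * t 0 0)
           else s 0 0 * t 0 0 + s 1 0 * t 1 0).
Proof.
rewrite /gamma_fam so_coordZ so_coord_Lstar varsigmaE !bilE GamStarE /sg.
by case: sB; case: sig; rewrite ?mx2M; ring.
Qed.

Lemma theta_famE b v w : so_coord (theta_fam b v w) =
  (if sB is Bplus then sg R sig else 1) * (4 * b ^+ 2)
    * (v 0 0 * w 1 0 - v 1 0 * w 0 0).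
Proof. by rewrite /theta_fam so_coordZ so_coord_Lstar mulr1 varsigmaE. Qed.

Lemma beta_bilinear b : bilinear_map (beta_fam b).
Proof.
split=> [v|s] a x y; apply: col2P; rewrite !entryE !beta_famE !entryE;
 by case: sB; case: sig; ring.
Qed.

Lemma gamma_bilinear b : bilinear_map (gamma_fam b).
Proof.
split=> [v|s] a x y; apply: so_inj; rewrite so_coord_lin !gamma_famE !entryE;
 by case: sig; ring.
Qed.

Lemma theta_bilinear b : bilinear_map (theta_fam b).
Proof.
by split=> [v|s] a x y; apply: so_inj; rewrite so_coord_lin !theta_famE !entryE; ring.
Qed.

Lemma gamma_fam_sym b s t : gamma_fam b s t = gamma_fam b t s.
Proof. by apply: so_inj; rewrite !gamma_famE; case: sig; ring. Qed.

Lemma family_cocycle b : normalised_cocycle sig sB (beta_fam b) (gamma_fam b).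
Proof.
split.
- exact: beta_bilinear.
- split; first exact: gamma_bilinear.
  exact: gamma_fam_sym.
- move=> s v; apply: col2P; rewrite !entryE kappaE act_VE
    !beta_famE gamma_famE /sg; by case: sB; case: sig; ring.
- move=> s; apply: col2P; rewrite !(addmxE, mx0E) act_Sc !beta_famE !kappaE gamma_famE;
  by case: sB; case: sig; field.
Qed.

Lemma family_integrated b : integrated_by sig sB (beta_fam b) (gamma_fam b) (theta_fam b).
Proof.
split.
- exact: theta_bilinear.
- move=> v s t; apply: so_inj.
  rewrite /Theta so_coordD !gamma_famE theta_famE !beta_famE !kappaE /sg.
  by case: sB; case: sig; ring.
- move=> v w s; apply: col2P;
  rewrite act_Sc !(addmxE, oppmxE) theta_famE !beta_famE /sg;
  by case: sB; case: sig; field.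
Qed.

(** Once Theta factors through kappa by the linear map [theta v], the sum moves inside [theta v] and
    becomes its value at 0. *)
Lemma integrated_annihilates (beta : 'cV[R]_2 -> 'cV[R]_2 -> 'cV[R]_2)
    (gamma : 'cV[R]_2 -> 'cV[R]_2 -> so R sig)
    (theta : 'cV[R]_2 -> 'cV[R]_2 -> so R sig) :
  integrated_by sig sB beta gamma theta ->
  annihilates_ker_kappa sB beta gamma.
Proof.
move=> [[thl _] Th _] v n s t k0.
under eq_bigr => i _ do rewrite Th.
have -> : forall m (f : 'I_m -> 'cV[R]_2),
    \sum_i theta v (f i) = theta v (\sum_i f i).
  elim=> [|m IH] f.
    rewrite !big_ord0; exact/esym/linear0_fun/thl.
  rewrite !big_ord_recl IH; have := thl v 1 (f ord0) (\sum_(i < m) f (lift ord0 i)).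
  by rewrite !scale1r.
rewrite k0; exact/linear0_fun/thl.
Qed.

Lemma bil_expand (W : lmodType R) (f : 'cV[R]_2 -> 'cV[R]_2 -> W) v s :
  bilinear_map f ->
  f v s = v 0 0 *: (s 0 0 *: f (Defs.basis 0) (Defs.basis 0)
                    + s 1 0 *: f (Defs.basis 0) (Defs.basis 1))
        + v 1 0 *: (s 0 0 *: f (Defs.basis 1) (Defs.basis 0)
                    + s 1 0 *: f (Defs.basis 1) (Defs.basis 1)).
Proof.
move=> [fr fl].
have dec u : u = u 0 0 *: Defs.basis 0 + u 1 0 *: Defs.basis 1 :> 'cV[R]_2.
  by apply: col2P; rewrite !mxE /= ?mulr1 ?mulr0 ?addr0 ?add0r.
have fr0 u : f u 0 = 0.
  exact/linear0_fun/fr.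
have fl0 u : f 0 u = 0.
  exact: (linear0_fun (fl u)).
have frZ u a x : f u (a *: x) = a *: f u x.
  by have := fr u a x 0; rewrite !addr0 fr0 addr0.
have flZ u a x : f (a *: x) u = a *: f x u.
  by have := fl u a x 0; rewrite /= !addr0 fl0 addr0.
have fE x : f x s = s 0 0 *: f x (Defs.basis 0) + s 1 0 *: f x (Defs.basis 1).
  by rewrite [in LHS](dec s) fr frZ.
by rewrite [in LHS](dec v) (fl s) flZ !fE.
Qed.

Lemma vecE (x y : R) : (vec x y 0 0 = x) * (vec x y 1 0 = y).
Proof. by rewrite !mxE. Qed.

Lemma cocycle_classification (beta : 'cV[R]_2 -> 'cV[R]_2 -> 'cV[R]_2)
    (gamma : 'cV[R]_2 -> 'cV[R]_2 -> so R sig) :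
  normalised_cocycle sig sB beta gamma ->
  exists b, (forall v s, beta v s = beta_fam b v s) /\
            (forall s t, gamma s t = gamma_fam b s t).
Proof.
move=> [bb [gb gsym] c1 c2].
set e0 : 'cV[R]_2 := Defs.basis 0; set e1 : 'cV[R]_2 := Defs.basis 1.
have bE v s i : beta v s i 0 =
    v 0 0 * (s 0 0 * beta e0 e0 i 0 + s 1 0 * beta e0 e1 i 0)
    + v 1 0 * (s 0 0 * beta e1 e0 i 0 + s 1 0 * beta e1 e1 i 0).
  by rewrite (bil_expand v s bb) !mxE.
have gE s t : so_coord (gamma s t) =
    s 0 0 * (t 0 0 * so_coord (gamma e0 e0) + t 1 0 * so_coord (gamma e0 e1))
    + s 1 0 * (t 0 0 * so_coord (gamma e0 e1) + t 1 0 * so_coord (gamma e1 e1)).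
  by rewrite (bil_expand s t gb) (gsym (Defs.basis 1) (Defs.basis 0)) !(so_coordD, so_coordZ).
have E1 (x y z u : R) i : (2 *: kappa sig sB (vec x y) (beta (vec z u) (vec x y))
   + act_V (gamma (vec x y) (vec x y)) (vec z u)) i 0 = 0.
  by rewrite c1 mxE.
(* In each case, the entry of beta whose value for the family is exactly the parameter. *)
pose b := match sB, sig with
  | Bplus, _ => beta e0 e0 1 0
  | Bminus, Sig11 => beta e0 e1 0 0
  | Bminus, Sig02 => beta e0 e0 0 0
  end.
have [[hb00 hb01 hb10 hb11] [hg0 hg1 hg2]] :
  [/\ beta e0 e0 = beta_fam b e0 e0, beta e0 e1 = beta_fam b e0 e1,
      beta e1 e0 = beta_fam b e1 e0 & beta e1 e1 = beta_fam b e1 e1] /\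
  [/\ so_coord (gamma e0 e0) = so_coord (gamma_fam b e0 e0),
      so_coord (gamma e0 e1) = so_coord (gamma_fam b e0 e1) &
      so_coord (gamma e1 e1) = so_coord (gamma_fam b e1 e1)].
  have F0 (x y z u : R) := E1 x y z u 0.
  have F1 (x y z u : R) := E1 x y z u 1.
  have := @cocycle_solve R sig sB (beta e0 e0 0 0) (beta e0 e1 0 0)
    (beta e1 e0 0 0) (beta e1 e1 0 0) (beta e0 e0 1 0) (beta e0 e1 1 0)
    (beta e1 e0 1 0) (beta e1 e1 1 0) (so_coord (gamma e0 e0)) (so_coord (gamma e0 e1))
    (so_coord (gamma e1 e1)).
  case=> [x y z u|x y z u|]; last first.
    move=> hg hb.
    have colE2 v w : v 0 0 = w 0 0 /\ v 1 0 = w 1 0 -> v = w.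
      by case; exact: col2P.
    have e0E : (e0 0 0 = 1) * (e0 1 0 = 0) by rewrite !mxE.
    have e1E : (e1 0 0 = 0) * (e1 1 0 = 1) by rewrite !mxE.
    rewrite !gamma_famE !e0E !e1E.
    split; last first.
      move: hg; rewrite /b; move: (so_coord (gamma e0 e0)) (so_coord (gamma e0 e1))
        (so_coord (gamma e1 e1)) => x y z; case: (sB); case: (sig) => /=; case=> -> -> ->; split; ring.
    split; apply: colE2; rewrite !beta_famE ?e0E ?e1E; move: hb; rewrite /b;
      case: (sB); case: (sig) => /=; case=> -[h1 h2 h3 h4] [h5 h6 h7 h8];
      rewrite 1?h1 1?h2 1?h3 1?h4 1?h5 1?h6 1?h7 1?h8; split; ring.
  - move: (F1 x y z u).
    by rewrite addmxE scalemxE act_VE kappaE !(bE (vec z u)) (gE (vec x y)) !vecE /sg !mulNr.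
  - move: (F0 x y z u).
    by rewrite addmxE scalemxE act_VE kappaE !(bE (vec z u)) (gE (vec x y)) !vecE.
exists b; split=> [v s|s t].
  rewrite (bil_expand v s bb) (bil_expand v s (beta_bilinear b)).
  by rewrite hb00 hb01 hb10 hb11.
apply: so_inj; rewrite gE hg0 hg1 hg2 !gamma_famE !mxE /=.
by case: (sig); ring.
Qed.

End Cocycles.

(** * The deformed superalgebra *)

Section Superspace.
Variables (R : realType) (sig : signature).
Local Notation X := (superspace R sig).
Implicit Types (x y z : X) (k : R).

Definition cV0 x : R := x.1.1 0 0.
Definition cV1 x : R := x.1.1 1 0.
Definition cL x : R := so_coord x.1.2.
Definition cS0 x : R := x.2 0 0.
Definition cS1 x : R := x.2 1 0.

Lemma superspace_ext x y :
  cV0 x = cV0 y -> cV1 x = cV1 y -> cL x = cL y -> cS0 x = cS0 y -> cS1 x = cS1 y ->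
  x = y.
Proof.
move: x y => [[v A] s] [[w A'] t] h0 h1 h2 h3 h4.
by congr ((_, _), _); [exact: col2P|exact: so_inj|exact: col2P].
Qed.

Lemma coord_add x y :
  (cV0 (x + y) = cV0 x + cV0 y) * (cV1 (x + y) = cV1 x + cV1 y) *
  (cL (x + y) = cL x + cL y) * (cS0 (x + y) = cS0 x + cS0 y) *
  (cS1 (x + y) = cS1 x + cS1 y).
Proof. by rewrite /cV0 /cV1 /cL /cS0 /cS1 !addmxE so_coordD. Qed.

Lemma coord_scale k x :
  (cV0 (k *: x) = k * cV0 x) * (cV1 (k *: x) = k * cV1 x) *
  (cL (k *: x) = k * cL x) * (cS0 (k *: x) = k * cS0 x) *
  (cS1 (k *: x) = k * cS1 x).
Proof. by rewrite /cV0 /cV1 /cL /cS0 /cS1 !scalemxE so_coordZ. Qed.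

Lemma coord_opp x :
  (cV0 (- x) = - cV0 x) * (cV1 (- x) = - cV1 x) *
  (cL (- x) = - cL x) * (cS0 (- x) = - cS0 x) * (cS1 (- x) = - cS1 x).
Proof. by rewrite /cV0 /cV1 /cL /cS0 /cS1 !oppmxE so_coordN. Qed.

Lemma coord0 : (cV0 0 = 0) * (cV1 0 = 0) * (cL 0 = 0) * (cS0 0 = 0) * (cS1 0 = 0).
Proof. by rewrite /cV0 /cV1 /cL /cS0 /cS1 !mx0E so_coord0. Qed.

Definition coordE := (coord_add, coord_scale, coord_opp, coord0).

Lemma parityP a x : has_parity a x <->
  if a then [/\ cV0 x = 0, cV1 x = 0 & cL x = 0] else cS0 x = 0 /\ cS1 x = 0.
Proof.
case: x a => [[v A] s] []; rewrite /cV0 /cV1 /cL /cS0 /cS1 /has_parity /=.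
  split=> [[-> ->]|[h0 h1 h2]]; first by rewrite !mx0E so_coord0.
  congr (_, _); first by apply: col2P; rewrite ?h0 ?h1 mx0E.
  by apply: so_inj; rewrite h2 so_coord0.
split=> [->|[h0 h1]]; first by rewrite !mx0E.
by apply: col2P; rewrite ?h0 ?h1 mx0E.
Qed.

Lemma gr_comp_m2 x : gr_comp (-2) x = ((x.1.1, 0), 0).
Proof. by case: x => [[v A] s]. Qed.
Lemma gr_comp_m1 x : gr_comp (-1) x = ((0, 0), x.2).
Proof. by case: x => [[v A] s]. Qed.
Lemma gr_comp_0 x : gr_comp 0 x = ((0, x.1.2), 0).
Proof. by case: x => [[v A] s]. Qed.
Lemma gr_comp_out (d : int) x : (d < -2) || (0 < d) -> gr_comp d x = 0.
Proof.
case: x => [[v A] s] h; rewrite /gr_comp.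
by do 3! [case: eqP => [e|_]; first by rewrite e in h].
Qed.

(** Only the degrees -2, -1 and 0 carry components, so the condition on all e < d reduces to three
    thresholds. *)
Lemma filtP (d : int) x : filt d x <->
  [/\ -2 < d -> cV0 x = 0 /\ cV1 x = 0, -1 < d -> cS0 x = 0 /\ cS1 x = 0
    & 0 < d -> cL x = 0].
Proof.
split=> [h|[h2 h1 h0] e ed].
  split=> hd; have := h _ hd; rewrite ?gr_comp_m2 ?gr_comp_m1 ?gr_comp_0;
    by case: x {h} => [[v A] s] [->]; rewrite /cV0 /cV1 /cL /cS0 /cS1 /= ?mx0E ?so_coord0.
have [e2|e2] := ltP e (-2); first by rewrite gr_comp_out ?e2.
have [e0|e0] := ltP 0 e; first by rewrite gr_comp_out ?e0 ?orbT.
have [|[|]] : e = -2 \/ e = -1 \/ e = 0 by lia.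
- move=> ee; rewrite ee gr_comp_m2; case: h2 => [|hq0 hq1]; first by rewrite -ee.
  by apply: superspace_ext; rewrite coordE /cV0 /cV1 /cL /cS0 /cS1 /= ?mx0E ?so_coord0.
- move=> ee; rewrite ee gr_comp_m1; case: h1 => [|hq0 hq1]; first by rewrite -ee.
  by apply: superspace_ext; rewrite coordE /cV0 /cV1 /cL /cS0 /cS1 /= ?mx0E ?so_coord0.
- move=> ee; rewrite ee gr_comp_0; have hq : cL x = 0 by apply: h0; rewrite -ee.
  by apply: superspace_ext; rewrite coordE /cV0 /cV1 /cL /cS0 /cS1 /= ?mx0E ?so_coord0.
Qed.

Section Deformation.
Variables (sB : bsign) (beta : 'cV[R]_2 -> 'cV[R]_2 -> 'cV[R]_2).
Variables (gamma : 'cV[R]_2 -> 'cV[R]_2 -> so R sig).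
Variables (theta : 'cV[R]_2 -> 'cV[R]_2 -> so R sig).
Local Notation br := (deformation sig sB beta gamma theta).

Lemma deformation_coord x y :
  (cV0 (br x y) = cL x * cV1 y - cL y * cV1 x
    + kap0 sig sB (cS0 x) (cS1 x) (cS0 y) (cS1 y)) *
  (cV1 (br x y) = sg R sig * (cL y * cV0 x - cL x * cV0 y)
    + kap1 sig sB (cS0 x) (cS1 x) (cS0 y) (cS1 y)) *
  (cL (br x y) = so_coord (theta x.1.1 y.1.1) + so_coord (gamma x.2 y.2)) *
  (cS0 (br x y) = (if sig is Sig11 then cL x * cS0 y - cL y * cS0 x
                  else cL x * cS1 y - cL y * cS1 x) / 2
       + beta x.1.1 y.2 0 0 - beta y.1.1 x.2 0 0) *
  (cS1 (br x y) = (if sig is Sig11 then cL y * cS1 x - cL x * cS1 y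
                  else cL y * cS0 x - cL x * cS0 y) / 2
       + beta x.1.1 y.2 1 0 - beta y.1.1 x.2 1 0).
Proof.
move: x y => [[v A] s] [[w A'] t]; rewrite /cV0 /cV1 /cL /cS0 /cS1 /=.
rewrite so_coordD !(addmxE, oppmxE, act_VE, kappaE, act_Sc).
move: (so_coord A) (so_coord A') (so_coord (theta v w)) (so_coord (gamma s t)) => l l' h g.
by split; [split; [split; [split|]|]|]; rewrite ?/kap0 ?/kap1;
  case: (sB); case: (sig) => /=; field.
Qed.

End Deformation.

Lemma flat_coord sB x y :
  (cV0 (flat_bracket sig sB x y) = cL x * cV1 y - cL y * cV1 x
    + kap0 sig sB (cS0 x) (cS1 x) (cS0 y) (cS1 y)) *
  (cV1 (flat_bracket sig sB x y) = sg R sig * (cL y * cV0 x - cL x * cV0 y)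
    + kap1 sig sB (cS0 x) (cS1 x) (cS0 y) (cS1 y)) *
  (cL (flat_bracket sig sB x y) = 0) *
  (cS0 (flat_bracket sig sB x y) = (if sig is Sig11 then cL x * cS0 y - cL y * cS0 x
                  else cL x * cS1 y - cL y * cS1 x) / 2) *
  (cS1 (flat_bracket sig sB x y) = (if sig is Sig11 then cL y * cS1 x - cL x * cS1 y
                  else cL y * cS0 x - cL x * cS0 y) / 2).
Proof. by rewrite !deformation_coord so_coord0 !mx0E !subr0 !addr0. Qed.

End Superspace.

Section Family.
Variables (R : realType) (sig : signature) (sB : bsign) (b : R).
Local Notation X := (superspace R sig).
Implicit Types (x y z : X) (k : R).

Local Ltac generalize_coord x :=
  move: (cV0 x) (cV1 x) (cL x) (cS0 x) (cS1 x) => ? ? ? ? ?.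

Local Ltac use_parity :=
  let H := fresh in let h1 := fresh in let h2 := fresh in let h3 := fresh in
  intro H; lazymatch type of H with
  | and3 _ _ _ => destruct H as [h1 h2 h3]; rewrite ?h1 ?h2 ?h3
  | _ /\ _ => destruct H as [h1 h2]; rewrite ?h1 ?h2
  end.

Definition tilde : X -> X -> X := deformation sig sB
  (beta_fam sig sB b) (gamma_fam sig sB b) (theta_fam sig sB b).

Lemma tilde_coord x y :
  (cV0 (tilde x y) = cL x * cV1 y - cL y * cV1 x
    + kap0 sig sB (cS0 x) (cS1 x) (cS0 y) (cS1 y)) *
  (cV1 (tilde x y) = sg R sig * (cL y * cV0 x - cL x * cV0 y)
    + kap1 sig sB (cS0 x) (cS1 x) (cS0 y) (cS1 y)) *
  (cL (tilde x y) =
     (if sB is Bplus then sg R sig else 1) * (4 * b ^+ 2)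
        * (cV0 x * cV1 y - cV1 x * cV0 y)
     + 2 * b * (if sig is Sig11 then - (cS0 x * cS1 y + cS1 x * cS0 y)
                else cS0 x * cS0 y + cS1 x * cS1 y)) *
  (cS0 (tilde x y) = (if sig is Sig11 then cL x * cS0 y - cL y * cS0 x
                  else cL x * cS1 y - cL y * cS1 x) / 2
     + b * match sB, sig with
     | _, Sig11 => (cV0 x + cV1 x) * cS1 y - (cV0 y + cV1 y) * cS1 x
     | Bplus, Sig02 => cV0 x * cS1 y - cV1 x * cS0 y - cV0 y * cS1 x + cV1 y * cS0 x
     | Bminus, Sig02 => cV0 x * cS0 y + cV1 x * cS1 y - cV0 y * cS0 x - cV1 y * cS1 x
     end) *
  (cS1 (tilde x y) = (if sig is Sig11 then cL y * cS1 x - cL x * cS1 y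
                  else cL y * cS0 x - cL x * cS0 y) / 2
     + b * match sB, sig with
     | Bplus, Sig11 => (cV0 x - cV1 x) * cS0 y - (cV0 y - cV1 y) * cS0 x
     | Bplus, Sig02 => cV0 x * cS0 y + cV1 x * cS1 y - cV0 y * cS0 x - cV1 y * cS1 x
     | Bminus, Sig11 => (cV1 x - cV0 x) * cS0 y - (cV1 y - cV0 y) * cS0 x
     | Bminus, Sig02 => cV1 x * cS0 y - cV0 x * cS1 y - cV1 y * cS0 x + cV0 y * cS1 x
     end).
Proof.
rewrite !deformation_coord !gamma_famE !theta_famE !beta_famE.
move: x y => [[v A] s] [[w A'] t]; rewrite /cV0 /cV1 /cL /cS0 /cS1 /=.
move: (so_coord A) (so_coord A') => l l'.
by split; [split; [split|]|]; case: sB; case: (sig) => //=; ring.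
Qed.

Lemma tilde_bilinear : bilinear_map tilde.
Proof.
split=> [x|x] k y z; apply: superspace_ext;
  rewrite !(tilde_coord, coordE) /kap0 /kap1;
  generalize_coord x; generalize_coord y; generalize_coord z;
  case: sB; case: (sig); ring.
Qed.

Lemma tilde_parity a a' x y : has_parity a x -> has_parity a' y ->
  has_parity (a (+) a') (tilde x y).
Proof.
move=> /parityP hx /parityP hy; apply/parityP.
have h0 := tilde_coord x y; rewrite !h0 {h0}.
case: a a' hx hy => [] [] /=; use_parity; use_parity;
  split; rewrite /kap0 /kap1;
  generalize_coord x; generalize_coord y;
  case: sB; case: (sig) => /=; ring.
Qed.

Lemma tilde_skew a a' x y : has_parity a x -> has_parity a' y ->
  tilde x y = - (-1) ^+ (a && a') *: tilde y x.
Proof.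
move=> /parityP hx /parityP hy.
apply: superspace_ext; rewrite coordE !tilde_coord;
  case: a a' hx hy => [] [] /=; use_parity; use_parity;
  rewrite ?expr0 ?expr1 /kap0 /kap1;
  generalize_coord x; generalize_coord y;
  case: sB; case: (sig) => /=; ring.
Qed.

Lemma tilde_jacobi a a' x y z : has_parity a x -> has_parity a' y ->
  tilde x (tilde y z) =
  tilde (tilde x y) z + (-1) ^+ (a && a') *: tilde y (tilde x z).
Proof.
move=> /parityP hx /parityP hy.
apply: superspace_ext; rewrite !coordE !tilde_coord;
  case: a a' hx hy => [] [] /=; use_parity; use_parity;
  rewrite ?expr0 ?expr1 /kap0 /kap1 /sg;
  generalize_coord x; generalize_coord y; generalize_coord z;
  by case: sB; case: (sig) => /=; field.
Qed.

End Family.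

Section FamilyProperties.
Variables (R : realType) (sig : signature) (sB : bsign) (b : R).
Local Notation X := (superspace R sig).
Local Notation tilde := (@tilde R sig sB b).
Implicit Types (x y z : X).

Lemma lie_superalgebra_tilde : lie_superalgebra tilde.
Proof.
split; [exact: tilde_bilinear|exact: tilde_parity|exact: tilde_skew|].
exact: tilde_jacobi.
Qed.

Lemma tilde0r x : tilde x 0 = 0.
Proof. exact: (linear0_fun ((tilde_bilinear sig sB b).1 x)). Qed.
Lemma tilde0l x : tilde 0 x = 0.
Proof. exact: (linear0_fun ((tilde_bilinear sig sB b).2 x)). Qed.

(** Elements of positive filtration vanish, which confines the next proof to degrees at most 0. *)
Lemma filt_coord (d : int) x : filt d x ->
  [/\ -2 < d -> cV0 x = 0 /\ cV1 x = 0, -1 < d -> cS0 x = 0 /\ cS1 x = 0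
    & 0 < d -> x = 0].
Proof.
move=> /[dup] /filtP[h2 h1 h0] hx; split=> // d0.
have d2 : -2 < d by lia.
have d1 : -1 < d by lia.
have [? ?] := h2 d2; have [? ?] := h1 d1.
by apply: superspace_ext; rewrite coordE //; exact: h0.
Qed.

Lemma coord_gr_m2 x :
  (cV0 (gr_comp (-2) x) = cV0 x) * (cV1 (gr_comp (-2) x) = cV1 x) *
  (cL (gr_comp (-2) x) = 0) * (cS0 (gr_comp (-2) x) = 0) *
  (cS1 (gr_comp (-2) x) = 0).
Proof. by rewrite gr_comp_m2 /cV0 /cV1 /cL /cS0 /cS1 /= !mx0E so_coord0. Qed.

Lemma coord_gr_m1 x :
  (cV0 (gr_comp (-1) x) = 0) * (cV1 (gr_comp (-1) x) = 0) *
  (cL (gr_comp (-1) x) = 0) * (cS0 (gr_comp (-1) x) = cS0 x) *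
  (cS1 (gr_comp (-1) x) = cS1 x).
Proof. by rewrite gr_comp_m1 /cV0 /cV1 /cL /cS0 /cS1 /= !mx0E so_coord0. Qed.

Lemma coord_gr_0 x :
  (cV0 (gr_comp 0 x) = 0) * (cV1 (gr_comp 0 x) = 0) *
  (cL (gr_comp 0 x) = cL x) * (cS0 (gr_comp 0 x) = 0) *
  (cS1 (gr_comp 0 x) = 0).
Proof. by rewrite gr_comp_0 /cV0 /cV1 /cL /cS0 /cS1 /= !mx0E. Qed.

Definition coord_gr := (coord_gr_m2, coord_gr_m1, coord_gr_0).

Lemma flat0 x : flat_bracket sig sB x 0 = 0 /\ flat_bracket sig sB 0 x = 0.
Proof.
by split; apply: superspace_ext; rewrite flat_coord !coordE /kap0 /kap1;
  move: (cV0 x) (cV1 x) (cL x) (cS0 x) (cS1 x) => ? ? ? ? ?;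
  case: sB; case: (sig); ring.
Qed.

Local Ltac ring_coord x y :=
  rewrite ?(tilde_coord, flat_coord, coord_gr, coordE) /kap0 /kap1;
  repeat match goal with H : _ = 0 |- _ => rewrite H; clear H end;
  move: (cV0 x) (cV1 x) (cL x) (cS0 x) (cS1 x) (cV0 y) (cV1 y) (cL y) (cS0 y) (cS1 y)
    => ? ? ? ? ? ? ? ? ? ?;
  case: sB; case: (sig) => /=; ring.

Lemma filtered_deformation_tilde : filtered_deformation sig sB tilde.
Proof.
have f0 (d : int) : filt d (0 : X) by apply/filtP; rewrite !coordE.
split; first exact: lie_superalgebra_tilde.
- move=> i j x y /filt_coord[hx2 hx1 hx0] /filt_coord[hy2 hy1 hy0].
  have [i0|i0] := ltP 0 i; first by rewrite hx0 // tilde0l; exact: f0.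
  have [j0|j0] := ltP 0 j; first by rewrite hy0 // tilde0r; exact: f0.
  apply/filtP; split=> ij; last by lia.
    (* With i, j <= 0, a total degree above -2 puts both arguments above -2 and one of them in
       degree 0, so kappa receives a zero spinor. *)
    have [x0 x1] : cV0 x = 0 /\ cV1 x = 0 by apply: hx2; lia.
    have [y0 y1] : cV0 y = 0 /\ cV1 y = 0 by apply: hy2; lia.
    have [i1|i1] := ltP (-1) i.
      by have [x3 x4] := hx1 i1; split; ring_coord x y.
    have [|y3 y4] := hy1; first by lia.
    by split; ring_coord x y.
  have [x0 x1] : cV0 x = 0 /\ cV1 x = 0 by apply: hx2; lia.
  have [y0 y1] : cV0 y = 0 /\ cV1 y = 0 by apply: hy2; lia.
  have [x3 x4] : cS0 x = 0 /\ cS1 x = 0 by apply: hx1; lia.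
  have [y3 y4] : cS0 y = 0 /\ cS1 y = 0 by apply: hy1; lia.
  by split; ring_coord x y.
- move=> i j x y /filt_coord[hx2 hx1 hx0] /filt_coord[hy2 hy1 hy0].
  have gr0 (d : int) : gr_comp d (0 : X) = 0.
    by apply: (f0 (d + 1)); lia.
  have [i0|i0] := ltP 0 i; first by rewrite hx0 // tilde0l !gr0 (flat0 _).2.
  have [j0|j0] := ltP 0 j; first by rewrite hy0 // tilde0r !gr0 (flat0 _).1.
  (* Below degree -2 the components vanish, and i + j then lies below -2 too since the other degree
     is at most 0. Nine pairs of degrees remain. *)
  have [i2|i2] := ltP i (-2).
    rewrite (gr_comp_out x); last by rewrite i2.
    by rewrite (flat0 _).2 gr_comp_out //; lia.
  have [j2|j2] := ltP j (-2).
    rewrite (gr_comp_out y); last by rewrite j2.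
    by rewrite (flat0 _).1 gr_comp_out //; lia.
  have [|[|]] : i = -2 \/ i = -1 \/ i = 0 by lia.
  all: have [|[|]] : j = -2 \/ j = -1 \/ j = 0 by lia.
  all: move=> ej ei; subst i j.
  + rewrite gr_comp_out //; apply: superspace_ext; ring_coord x y.
  + have [y0 y1] := hy2 isT.
    rewrite gr_comp_out //; apply: superspace_ext; ring_coord x y.
  + have [y0 y1] := hy2 isT; have [y3 y4] := hy1 isT.
    rewrite addr0; apply: superspace_ext; ring_coord x y.
  + have [x0 x1] := hx2 isT.
    rewrite gr_comp_out //; apply: superspace_ext; ring_coord x y.
  + have [x0 x1] := hx2 isT; have [y0 y1] := hy2 isT.
    rewrite (_ : -1 + -1 = -2) //; apply: superspace_ext; ring_coord x y.
  + have [x0 x1] := hx2 isT; have [y0 y1] := hy2 isT.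
    have [y3 y4] := hy1 isT.
    rewrite addr0; apply: superspace_ext; ring_coord x y.
  + have [x0 x1] := hx2 isT; have [x3 x4] := hx1 isT.
    rewrite add0r; apply: superspace_ext; ring_coord x y.
  + have [x0 x1] := hx2 isT; have [y0 y1] := hy2 isT.
    have [x3 x4] := hx1 isT.
    rewrite add0r; apply: superspace_ext; ring_coord x y.
  + have [x0 x1] := hx2 isT; have [y0 y1] := hy2 isT.
    have [x3 x4] := hx1 isT; have [y3 y4] := hy1 isT.
    rewrite addr0; apply: superspace_ext; ring_coord x y.
Qed.

Lemma coord_L : (cV0 (L_ sig : X) = 0) * (cV1 (L_ sig : X) = 0) *
  (cL (L_ sig : X) = 1) * (cS0 (L_ sig : X) = 0) * (cS1 (L_ sig : X) = 0).
Proof. by rewrite /cV0 /cV1 /cL /cS0 /cS1 /= !mx0E so_coord_Lstar. Qed.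

Lemma coord_S s : (cV0 (inS s : X) = 0) * (cV1 (inS s : X) = 0) *
  (cL (inS s : X) = 0) * (cS0 (inS s : X) = s 0 0) * (cS1 (inS s : X) = s 1 0).
Proof. by rewrite /cV0 /cV1 /cL /cS0 /cS1 /= !mx0E so_coord0. Qed.

Lemma coord_P mu : (cV0 (P_ sig mu : X) = (mu == 0)%:R) *
  (cV1 (P_ sig mu : X) = (mu == 1)%:R) *
  (cL (P_ sig mu : X) = 0) * (cS0 (P_ sig mu : X) = 0) * (cS1 (P_ sig mu : X) = 0).
Proof.
rewrite /cV0 /cV1 /cL /cS0 /cS1 /= !mx0E so_coord0 !mxE.
by rewrite !andbT ![_ == mu]eq_sym.
Qed.

Definition coord_gen := (coord_L, coord_S, coord_P).

Lemma epsE : (eps 0 0 = 0 :> R) * (eps 0 1 = 1 :> R) * (eps 1 0 = -1 :> R) *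
  (eps 1 1 = 0 :> R).
Proof. by rewrite /eps !mxE. Qed.

Lemma tilde_L :
  (forall s, tilde (L_ sig) (inS s) = inS (2^-1 *: (GamStar sig *m s))) /\
  (forall mu, tilde (L_ sig) (P_ sig mu)
     = - varsigma sig *: \sum_nu eps mu nu *: P_up sig nu).
Proof.
split=> [s|].
  apply: superspace_ext; rewrite !(tilde_coord, coord_gen) ?scalemxE ?GamStarE
    /kap0 /kap1; case: sB; case: (sig); rewrite ?mx2M /=; ring.

by elim/ord2P; rewrite sum2 /P_up !raiseE !epsE; apply: superspace_ext;
 rewrite !(tilde_coord, coordE, coord_gen) /= varsigmaE /kap0 /kap1; case: sB;
 case: (sig); rewrite /sg; ring.
Qed.

Lemma tilde_brackets :
  match sB with
  | Bplus =>
      [/\ forall mu nu, tilde (P_ sig mu) (P_ sig nu) =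
            (varsigma sig * 4 * b ^+ 2 * eps mu nu) *: L_ sig,
          forall mu s, tilde (P_ sig mu) (inS s) =
            inS (b *: \sum_nu eps mu nu *: (Gam_up sig nu *m s))
        & forall s, tilde (inS s) (inS s) =
            \sum_mu kappa sig sB s s mu 0 *: P_ sig mu
            + (varsigma sig * 2 * b * bil sig sB s s) *: L_ sig]
  | Bminus =>
      [/\ forall mu nu, tilde (P_ sig mu) (P_ sig nu) =
            (4 * b ^+ 2 * eps mu nu) *: L_ sig,
          forall mu s, tilde (P_ sig mu) (inS s) = inS (b *: (Gam sig mu *m s))
        & forall s, tilde (inS s) (inS s) =
            \sum_mu kappa sig sB s s mu 0 *: P_ sig mu
            - (varsigma sig * 2 * b * bil sig sB s (GamStar sig *m s)) *: L_ sig]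
  end.
Proof.
case: sB; split.
- by elim/ord2P; elim/ord2P; apply: superspace_ext;
   rewrite !(tilde_coord, coordE, coord_gen) epsE varsigmaE /= /kap0 /kap1 /sg;
   case: (sig); ring.
- by elim/ord2P=> s; apply: superspace_ext;
   rewrite !(tilde_coord, coord_gen) /kap0 /kap1 /= ?scalemxE ?sum2 ?addmxE
    ?scalemxE ?epsE ?Gam_upE; case: (sig); rewrite ?mx2M; ring.
- by move=> s; apply: superspace_ext;
   rewrite sum2 !(tilde_coord, coordE, coord_gen) !kappaE bilE varsigmaE
     /kap0 /kap1 /sg /=; case: (sig); ring.
- by elim/ord2P; elim/ord2P; apply: superspace_ext;
   rewrite !(tilde_coord, coordE, coord_gen) epsE /= /kap0 /kap1;
   case: (sig); ring.
- by elim/ord2P=> s; apply: superspace_ext;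
   rewrite !(tilde_coord, coord_gen) /kap0 /kap1 /= ?scalemxE
    ?GamE; case: (sig); rewrite ?mx2M; ring.
- by move=> s; apply: superspace_ext;
   rewrite sum2 !(tilde_coord, coordE, coord_gen) !kappaE bilE varsigmaE GamStarE
     /kap0 /kap1 /sg /=; case: (sig); rewrite ?mx2M; ring.
Qed.

Lemma odd_part_generates (U : {vspace X}) : b != 0 ->
  subsuperalgebra tilde U -> (forall s, inS s \in U) -> U = fullv.
Proof.
move=> b0 [_ brU] SU; apply/vspaceP=> x; rewrite memvf.
pose f i j := tilde (inS (Defs.basis i)) (inS (Defs.basis j)).
have fU i j : f i j \in U by apply: brU.
suff [a [c [d ->]]] : exists a c d : R,
    x = a *: f 0 0 + c *: f 1 1 + d *: f 0 1 + inS x.2.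
  by rewrite !memvD ?memvZ.
(* The witnesses invert the matrix of the bracket from Sym^2 S to V + so(V). Its so(V) row carries
   the factor 2b, hence the division. *)
pose l := cL x / (2 * b).
exists (match sB, sig with
  | _, Sig11 => (cV0 x + cV1 x) / 2
  | Bplus, Sig02 => (l + cV0 x) / 2
  | Bminus, Sig02 => (l + cV1 x) / 2 end).
exists (match sB, sig with
  | Bplus, Sig11 => (cV1 x - cV0 x) / 2
  | Bminus, Sig11 => (cV0 x - cV1 x) / 2
  | Bplus, Sig02 => (l - cV0 x) / 2
  | Bminus, Sig02 => (l - cV1 x) / 2 end).
exists (match sB, sig with
  | _, Sig11 => - l
  | Bplus, Sig02 => cV1 x
  | Bminus, Sig02 => - cV0 x end).
have e0E : (Defs.basis 0 : 'cV[R]_2) 0 0 = 1 /\ (Defs.basis 0 : 'cV[R]_2) 1 0 = 0.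
  by rewrite !mxE.
have e1E : (Defs.basis 1 : 'cV[R]_2) 0 0 = 0 /\ (Defs.basis 1 : 'cV[R]_2) 1 0 = 1.
  by rewrite !mxE.
rewrite /l {l}; apply: superspace_ext; rewrite /f !(coordE, tilde_coord, coord_gen)
  !(e0E.1, e0E.2) ?(e1E.1, e1E.2) -?[x.2 0 0]/(cS0 x) -?[x.2 1 0]/(cS1 x) /kap0 /kap1;
  move: (cV0 x) (cV1 x) (cL x) (cS0 x) (cS1 x) => ? ? ? ? ?;
  by case: sB; case: (sig) => /=; field.
Qed.

End FamilyProperties.

(** * The even part as a metric Lie pair *)

Section EvenPart.
Variables (R : realType) (sig : signature) (sB : bsign) (b : R).
Local Notation g := (even_part R sig).
Implicit Types (x y : g) (k : R).

Definition eV0 x : R := x.1 0 0.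
Definition eV1 x : R := x.1 1 0.
Definition eL x : R := so_coord x.2.

Lemma even_ext x y : eV0 x = eV0 y -> eV1 x = eV1 y -> eL x = eL y -> x = y.
Proof.
move: x y => [v A] [w A'] h0 h1 h2.
by congr (_, _); [exact: col2P|exact: so_inj].
Qed.

Lemma even_lin k x y :
  (eV0 (k *: x + y) = k * eV0 x + eV0 y) * (eV1 (k *: x + y) = k * eV1 x + eV1 y) *
  (eL (k *: x + y) = k * eL x + eL y).
Proof. by rewrite /eV0 /eV1 /eL !addmxE !scalemxE so_coord_lin. Qed.

Lemma even0 : (eV0 0 = 0) * (eV1 0 = 0) * (eL 0 = 0).
Proof. by rewrite /eV0 /eV1 /eL !mx0E so_coord0. Qed.

(** The coefficient of L_* in [P_0, P_1]. *)
Definition even_curv : R := (if sB is Bplus then sg R sig else 1) * (4 * b ^+ 2).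

Local Notation br0 := (even_bracket (tilde sB b : _ -> _ -> superspace R sig)).

Lemma even_bracket_coord x y :
  (eV0 (br0 x y) = eL x * eV1 y - eL y * eV1 x) *
  (eV1 (br0 x y) = sg R sig * (eL y * eV0 x - eL x * eV0 y)) *
  (eL (br0 x y) = even_curv * (eV0 x * eV1 y - eV1 x * eV0 y)).
Proof.
have e := tilde_coord sB b ((x, 0) : superspace R sig) (y, 0).
move: x y e => [v A] [w A'] e; rewrite /eV0 /eV1 /eL /even_bracket.
rewrite -[(tilde _ _ _ _).1.1 0 0]/(cV0 _) -[(tilde _ _ _ _).1.1 1 0]/(cV1 _).
rewrite -[so_coord (tilde _ _ _ _).1.2]/(cL _) !e /cV0 /cV1 /cL /cS0 /cS1 /= !mx0E /kap0 /kap1.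
move: (so_coord A) (so_coord A') => l l' {e}.
by rewrite /even_curv; split; [split|]; case: sB; case: (sig) => /=; ring.
Qed.

Lemma even_metricE x y : even_metric x y = sg R sig * eV0 x * eV0 y + eV1 x * eV1 y.
Proof.
rewrite /even_metric /etab -mulmxA mxE sum2 ![_^T _ _]mxE etaE !mx2M /eV0 /eV1; ring.
Qed.

Lemma even_isotropyP x : even_isotropy x <-> eV0 x = 0 /\ eV1 x = 0.
Proof.
split=> [h|[h0 h1]]; first by rewrite /eV0 /eV1 h !mx0E.
by apply: col2P; rewrite mx0E.
Qed.

Lemma metric_lie_pair_even : metric_lie_pair br0 even_isotropy even_metric.
Proof.
split.
- split=> [|a x y]; first by apply/even_isotropyP; rewrite !even0.
  move=> /even_isotropyP[x0 x1] /even_isotropyP[y0 y1]; apply/even_isotropyP.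
  by rewrite !even_lin x0 x1 y0 y1 !mulr0 !addr0.
- move=> x y /even_isotropyP[x0 x1] /even_isotropyP[y0 y1]; apply/even_isotropyP.
  by rewrite !even_bracket_coord x0 x1 y0 y1 !mulr0 !subr0 !mulr0.
- split=> [x y|a x y z]; first by rewrite !even_metricE; ring.
  by rewrite !even_metricE !even_lin; ring.
- move=> x; split=> [/even_isotropyP[x0 x1] y|h].
    by rewrite even_metricE x0 x1 !mulr0 !mul0r addr0.
  apply/even_isotropyP.
  have := h ((Defs.basis 0, 0) : g); have := h ((Defs.basis 1, 0) : g).
  rewrite !even_metricE /eV0 /eV1 /= !mxE /= !mulr0 !mulr1 !addr0 add0r => -> h0.
  split=> //; move: h0; move: (x.1 0 0) => u; rewrite /sg; case: (sig); lra.
- move=> a x y /even_isotropyP[a0 a1].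
  rewrite !even_metricE !even_bracket_coord a0 a1 /sg.
  move: (eV0 x) (eV1 x) (eL x) (eV0 y) (eV1 y) (eL a) => ? ? ? ? ? ?.
  by case: (sig); ring.
Qed.

End EvenPart.

(** * Hyperbolic functions and their derivatives *)

Section PointwiseDerivatives.
Variables (R : realType) (V : normedModType R).
Implicit Types (f g : V -> R) (x v : V).

(** Pointwise forms of the rules, so that derivatives of lambda terms are assembled by plain
    application. *)
Lemma is_derive_add f g x v df dg : is_derive x v f df -> is_derive x v g dg ->
  is_derive x v (fun y => f y + g y) (df + dg).
Proof. by move=> hf hg; exact: (is_deriveD hf hg). Qed.

Lemma is_derive_mul f g x v df dg : is_derive x v f df -> is_derive x v g dg ->
  is_derive x v (fun y => f y * g y) (f x * dg + g x * df).
Proof. by move=> hf hg; exact: (is_deriveM hf hg). Qed.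

Lemma is_derive_scale f k x v df : is_derive x v f df ->
  is_derive x v (fun y => k * f y) (k * df).
Proof. by move=> hf; exact: (is_deriveZ k hf). Qed.

End PointwiseDerivatives.

Section Hyperbolic.
Variable R : realType.
Implicit Types t : R.

Definition ch t : R := (expR t + expR (- t)) / 2.
Definition sh t : R := (expR t - expR (- t)) / 2.
Definition th t : R := sh t / ch t.

Lemma ch_gt0 t : 0 < ch t.
Proof. by rewrite divr_gt0 // addr_gt0 // expR_gt0. Qed.

Lemma ch_neq0 t : ch t != 0.
Proof. by rewrite gt_eqF // ch_gt0. Qed.

Lemma ch2sh2 t : ch t ^+ 2 = 1 + sh t ^+ 2.
Proof.
have h : expR t * expR (- t) = 1 by rewrite expRN mulfV // gt_eqF // expR_gt0.
rewrite -[1 in RHS]h /ch /sh.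
by move: (expR t) (expR (- t)) => x y; field.
Qed.

Lemma ch0 : ch 0 = 1. Proof. by rewrite /ch oppr0 expR0; field. Qed.
Lemma sh0 : sh 0 = 0. Proof. by rewrite /sh oppr0 subrr mul0r. Qed.
Lemma th0 : th 0 = 0. Proof. by rewrite /th sh0 mul0r. Qed.

Lemma th_ch t : th t * ch t = sh t.
Proof. by rewrite /th divfK // ch_neq0. Qed.

Lemma th2_ch2 t : th t ^+ 2 * ch t ^+ 2 = ch t ^+ 2 - 1.
Proof.
rewrite -exprMn th_ch ch2sh2; ring.
Qed.

Lemma is_derive_expRN t : is_derive t 1 (fun u => expR (- u)) (- expR (- t)).
Proof.
have := @is_derive1_comp R expR -%R t _ _ (is_derive_expR _) (is_deriveNid t 1).
by rewrite mulrN1.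
Qed.

Lemma is_derive_ch t : is_derive t 1 ch (sh t).
Proof.
have h := is_derive_scale 2^-1 (is_derive_add (is_derive_expR t) (is_derive_expRN t)).
rewrite (_ : ch = fun u => 2^-1 * (expR u + expR (- u))); last first.
  by apply/funext => u; rewrite /ch mulrC.
by apply: is_derive_eq h _; rewrite /sh mulrC.
Qed.

Lemma is_derive_sh t : is_derive t 1 sh (ch t).
Proof.
have hN : is_derive t 1 (fun u => - expR (- u)) (expR (- t)).
  by have := is_deriveN (is_derive_expRN t); rewrite opprK.
have h := is_derive_scale 2^-1 (is_derive_add (is_derive_expR t) hN).
rewrite (_ : sh = fun u => 2^-1 * (expR u - expR (- u))); last first.
  by apply/funext => u; rewrite /sh mulrC.
by apply: is_derive_eq h _; rewrite /ch mulrC.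
Qed.

Lemma is_derive_th t : is_derive t 1 th (1 - th t ^+ 2).
Proof.
have [dc ec] := is_derive_ch t; have [ds es] := is_derive_sh t.
have dv : derivable (fun u => (ch u)^-1) t 1 by exact: derivableV (ch_neq0 t) dc.
apply: (@DeriveDef _ _ _ _ _ th); first exact: derivableM ds dv.
have -> : th = sh * (fun u => (ch u)^-1) by [].
rewrite (deriveM ds dv) (deriveV (ch_neq0 t) dc) ec es /th /=.
rewrite /GRing.scale /= mulrfctE.
have := ch_neq0 t; move: (ch t) (sh t) => c s c0; by field.
Qed.

(** The inverse is ln (x + s) with s = sqrt (1 + x^2): here |x| < s makes the argument positive, and
    (s + x)(s - x) = 1 gives its inverse. *)
Lemma sh_surj (x : R) : exists t, sh t = x.
Proof.
have h1 : 0 < 1 + x ^+ 2 by have := sqr_ge0 x; lra.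
have h : 0 < x + Num.sqrt (1 + x ^+ 2).
  have : `|x| < Num.sqrt (1 + x ^+ 2).
    by rewrite -sqrtr_sqr ltr_sqrt //; lra.
  by move=> /ltr_normlP[hx _]; move: hx; move: (Num.sqrt _) => s; lra.
exists (ln (x + Num.sqrt (1 + x ^+ 2))).
rewrite /sh expRN lnK ?posrE //.
have := sqr_sqrtr (ltW h1).
move: h; move: (Num.sqrt _) => s h e; have h0 : x + s != 0 by rewrite gt_eqF.
by field : e.
Qed.

End Hyperbolic.

(** * Parametrised quadrics *)

Section Angular.
Variables (R : realType) (circ : bool).
Implicit Types u : R.

(** The sign e in C' = e S, where C and S are [co] and [si]. *)
Definition ang : R := if circ then -1 else 1.
Definition co u : R := if circ then cos u else ch u.
Definition si u : R := if circ then sin u else sh u.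

Lemma angM : ang * ang = 1.
Proof. by rewrite /ang; case: circ; rewrite ?mulrNN mulr1. Qed.

Lemma co2si2 u : co u ^+ 2 = 1 + ang * si u ^+ 2.
Proof.
rewrite /co /si /ang; case: circ; last by rewrite mul1r ch2sh2.
by rewrite mulN1r cos2sin2.
Qed.

Lemma co0 : co 0 = 1. Proof. by rewrite /co; case: circ; rewrite ?cos0 ?ch0. Qed.
Lemma si0 : si 0 = 0. Proof. by rewrite /si; case: circ; rewrite ?sin0 ?sh0. Qed.

Lemma is_derive_co u : is_derive u 1 co (ang * si u).
Proof.
rewrite /co /si /ang; case: circ; last by rewrite mul1r; exact: is_derive_ch.
by rewrite mulN1r; exact: is_derive_cos.
Qed.

Lemma is_derive_si u : is_derive u 1 si (co u).
Proof.
by rewrite /co /si; case: circ; [exact: is_derive_sin|exact: is_derive_sh].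
Qed.

(** On the circle [acos x] has sine |y|, and the opposite angle serves when y < 0. On the hyperbola
    y determines u, and x, being positive, is determined by its square. *)
Lemma co_si_surj (x y : R) : x ^+ 2 = 1 + ang * y ^+ 2 ->
  (ang = 1 -> 0 < x) -> exists u, co u = x /\ si u = y.
Proof.
rewrite /co /si /ang; case: circ => [h _|h /(_ erefl) x0].
  have x1 : -1 <= x <= 1.
    by rewrite -ler_norml -sqrtr_sqr -sqrtr1 ler_wsqrtr // h; have := sqr_ge0 y; lra.
  have s2 : sin (acos x) = `|y|.
    by rewrite sin_acos // h -sqrtr_sqr; congr Num.sqrt; ring.
  have cx : cos (acos x) = x by rewrite acosK // in_itv.
  have [y0|y0] := ger0P y.
    by exists (acos x); rewrite cx s2 ger0_norm.
  exists (- acos x); rewrite cosN sinN cx s2 ltr0_norm ?opprK //.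
have [u su] := sh_surj y; exists u; split=> //.
apply/eqP; rewrite -(@eqrXn2 _ 2) ?ltW ?ch_gt0 //.
by rewrite ch2sh2 su h mul1r.
Qed.

Lemma co_gt0 u : ang = 1 -> 0 < co u.
Proof.
rewrite /ang /co; case: circ => [h|_]; last exact: ch_gt0.
by exfalso; lra.
Qed.

End Angular.

(** * Symbolic differentiation of functions of two coordinates *)

Section Expressions.
Variables (R : realType) (circ : bool).
Local Notation plane := 'rV[R]_2.
Implicit Types (p v : plane).

(* Syntax for functions of (t, u) = (p 0 0, p 0 1): the class is closed under
   both partial derivatives, which makes smoothness automatic and turns
   differentiation into computation. *)
Inductive expr :=
  | Cst of R | Ch | Sh | Th | Co | Si | Add of expr & expr | Mul of expr & expr.

Fixpoint ev (x : expr) p : R :=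
  match x with
  | Cst a => a
  | Ch => ch (p 0 0)
  | Sh => sh (p 0 0)
  | Th => th (p 0 0)
  | Co => co circ (p 0 1)
  | Si => si circ (p 0 1)
  | Add x y => ev x p + ev y p
  | Mul x y => ev x p * ev y p
  end.

Fixpoint pdx (i : 'I_2) (x : expr) : expr :=
  match x with
  | Cst _ => Cst 0
  | Ch => if i == 0 then Sh else Cst 0
  | Sh => if i == 0 then Ch else Cst 0
  | Th => if i == 0 then Add (Cst 1) (Mul (Cst (-1)) (Mul Th Th)) else Cst 0
  | Co => if i == 0 then Cst 0 else Mul (Cst (ang R circ)) Si
  | Si => if i == 0 then Cst 0 else Co
  | Add x y => Add (pdx i x) (pdx i y)
  | Mul x y => Add (Mul x (pdx i y)) (Mul y (pdx i x))
  end.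

Definition ddx v x := Add (Mul (Cst (v 0 0)) (pdx 0 x)) (Mul (Cst (v 0 1)) (pdx 1 x)).

Lemma differentiable_coord_comp (f : R -> R) i p a :
  is_derive (p 0 i) 1 f a -> differentiable (fun q : plane => f (q 0 i)) p.
Proof.
move=> [df _].
apply: (@differentiable_comp _ _ _ _ (fun q : plane => q 0 i : R) f).
  exact: differentiable_coord.
exact/derivable1_diffP.
Qed.

Lemma is_derive_coord (i : 'I_2) p v : is_derive p v (fun q : plane => q 0 i) (v 0 i).
Proof.
have := @is_derive_id R plane p v => -[d e].
apply: DeriveDef; first exact: ((derivable_mxP _ _ _).1 d).
by have := congr1 (fun w : plane => w 0 i) e; rewrite derive_mx // mxE.
Qed.

Lemma is_derive_coord_comp (f : R -> R) i p v a :
  is_derive (p 0 i) 1 f a -> is_derive p v (fun q : plane => f (q 0 i)) (v 0 i * a).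
Proof.
move=> /[dup] fa /differentiable_coord_comp dfc.
apply: DeriveDef; first exact: diff_derivable.
have [d e] := fa.
rewrite deriveE // (@diff_comp _ _ _ _ (fun q : plane => q 0 i : R) f); first last.
- exact/derivable1_diffP.
- exact: differentiable_coord.
rewrite /= -(deriveE _ (differentiable_coord p 0 i)).
rewrite (deriv1E d) derive1E e.
by have [_ ->] := is_derive_coord i p v.
Qed.

Lemma differentiable_ev x p : differentiable (ev x) p.
Proof.
elim: x => [a|||||||] /=.
- exact: differentiable_cst.
- exact: (differentiable_coord_comp (is_derive_ch _)).
- exact: (differentiable_coord_comp (is_derive_sh _)).
- exact: (differentiable_coord_comp (is_derive_th _)).
- exact: (differentiable_coord_comp (is_derive_co circ _)).
- exact: (differentiable_coord_comp (is_derive_si circ _)).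
- by move=> x dx y dy; exact: differentiableD.
- by move=> x dx y dy; exact: differentiableM.
Qed.

Lemma is_derive_ev x p v : is_derive p v (ev x) (ev (ddx v x) p).
Proof.
elim: x => [a|||||||] /=.
- by apply: is_derive_eq (is_derive_cst _ _ _) _; ring.
- by apply: is_derive_eq (is_derive_coord_comp _ (is_derive_ch _)) _; ring.
- by apply: is_derive_eq (is_derive_coord_comp _ (is_derive_sh _)) _; ring.
- by apply: is_derive_eq (is_derive_coord_comp _ (is_derive_th _)) _; ring.
- by apply: is_derive_eq (is_derive_coord_comp _ (is_derive_co circ _)) _; ring.
- by apply: is_derive_eq (is_derive_coord_comp _ (is_derive_si circ _)) _; ring.
- by move=> x dx y dy; apply: is_derive_eq (is_derive_add dx dy) _; rewrite /=; ring.
- by move=> x dx y dy; apply: is_derive_eq (is_derive_mul dx dy) _; rewrite /=; ring.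
Qed.

Lemma derive_ev x p v : 'D_v (ev x) p = ev (ddx v x) p.
Proof. by have [] := is_derive_ev x p v. Qed.

Lemma pd_ev i x p : pd i (ev x) p = ev (pdx i x) p.
Proof.
rewrite /pd derive_ev /= !mxE /=; elim/ord2P: i; rewrite /=; ring.
Qed.

Definition row_ev n (F : 'I_n -> expr) p : 'rV[R]_n := \row_j ev (F j) p.

Lemma derive_row_ev n (F : 'I_n -> expr) p v :
  'D_v (row_ev F) p = row_ev (fun j => ddx v (F j)) p.
Proof.
rewrite derive_mx; last first.
  apply/derivable_mxP => i j.
  rewrite (_ : (fun _ => _) = ev (F j)); last by apply/funext => q; rewrite mxE.
  by have [] := is_derive_ev (F j) p v.
apply/rowP => j; rewrite !mxE -derive_ev.
by congr ('D_v _ p); apply/funext => q; rewrite mxE.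
Qed.

Lemma differentiable_row (n : nat) (f : plane -> 'rV[R]_n) p :
  (forall j, differentiable (fun q => f q 0 j) p) -> differentiable f p.
Proof.
move=> df.
have -> : f = \sum_j (fun q => f q 0 j *: delta_mx 0 j).
  by apply/funext => q; rewrite fct_sumE [LHS]row_sum_delta.
by apply: differentiable_sum => j; exact: differentiableZl.
Qed.

Lemma smooth_row_ev n (F : 'I_n -> expr) : smooth (row_ev F).
Proof.
move=> k; elim: k n F => [|k IH] n F.
  move=> p; apply: differentiable_continuous; apply: differentiable_row => j.
  rewrite (_ : (fun _ => _) = ev (F j)); last by apply/funext => q; rewrite mxE.
  exact: differentiable_ev.
split=> [p|v].
  apply: differentiable_row => j.
  rewrite (_ : (fun _ => _) = ev (F j)); last by apply/funext => q; rewrite mxE.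
  exact: differentiable_ev.
rewrite (_ : (fun _ => _) = row_ev (fun j => ddx v (F j))); first exact: IH.
by apply/funext => p; exact: derive_row_ev.
Qed.

End Expressions.

Arguments Ch {R}.
Arguments Sh {R}.
Arguments Th {R}.
Arguments Co {R}.
Arguments Si {R}.

(** * Restriction to lines, and one-parameter exponentials *)

Section Lines.
Variables (R : realType).

(** Both difference quotients are the same function of h, so the one directional derivative of [f]
    is enough. *)
Lemma is_derive_line (V W : normedModType R) (f : V -> W) (p v : V) (t : R) df :
  is_derive (p + t *: v) v f df -> is_derive t 1 (fun s : R => f (p + s *: v)) df.
Proof.
have E : (fun h : R => h^-1 *: (((fun s : R => f (p + s *: v)) \o shift t) (h *: 1)
             - f (p + t *: v))) =
    (fun h : R => h^-1 *: ((f \o shift (p + t *: v)) (h *: v) - f (p + t *: v))).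
  apply/funext => h /=; congr (_ *: (f _ - _)).
  by rewrite scalerDl [h%:A]mulr1 addrCA.
by move=> [d e]; split; [rewrite /derivable E|rewrite /derive E].
Qed.

Lemma is_derive_mx (V : normedModType R) m n (f : V -> 'M[R]_(m, n))
    x v (df : 'M[R]_(m, n)) :
  (forall i j, is_derive x v (fun y => f y i j) (df i j)) -> is_derive x v f df.
Proof.
move=> h; have d : derivable f x v by apply/derivable_mxP => i j; case: (h i j).
by apply: DeriveDef => //; rewrite derive_mx //; apply/matrixP => i j;
  rewrite mxE; case: (h i j).
Qed.

Lemma is_derive_unique (V W : normedModType R) (f : V -> W) x v df df' :
  is_derive x v f df -> is_derive x v f df' -> df = df'.
Proof. by move=> [_ <-] [_ <-]. Qed.

Definition pt (t u : R) : 'rV[R]_2 := \row_i (if i == 0 then t else u).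

Lemma ptE t u : (pt t u 0 0 = t) * (pt t u 0 1 = u).
Proof. by rewrite !mxE. Qed.

Lemma row2P (p q : 'rV[R]_2) : p 0 0 = q 0 0 -> p 0 1 = q 0 1 -> p = q.
Proof. by move=> h0 h1; apply/rowP; elim/ord2P. Qed.

Lemma pt_eta (p : 'rV[R]_2) : p = pt (p 0 0) (p 0 1).
Proof. by apply: row2P; rewrite ptE. Qed.

Lemma pt_line t u s : (pt t u + s *: delta_mx 0 0 = pt (t + s) u) *
  (pt t u + s *: delta_mx 0 1 = pt t (u + s)).
Proof.
by split; apply: row2P; rewrite !(addmxE, scalemxE, ptE, mxE) /= ?mulr0 ?mulr1
  ?addr0.
Qed.

(** Turns a partial derivative into an ordinary one along a coordinate line, where the Killing
    equations can be integrated. *)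
Lemma is_derive_slice0 (f : 'rV[R]_2 -> R) t u :
  derivable f (pt t u) (delta_mx 0 0) ->
  is_derive t 1 (fun s => f (pt s u)) (pd 0 f (pt t u)).
Proof.
move=> /derivableP.
have := @is_derive_line _ _ f (pt 0 u) (delta_mx 0 0) t.
rewrite pt_line add0r => h /h.
by rewrite (_ : (fun _ => _) = (fun s => f (pt s u))) //; apply/funext => s;
  rewrite pt_line add0r.
Qed.

Lemma is_derive_slice1 (f : 'rV[R]_2 -> R) t u :
  derivable f (pt t u) (delta_mx 0 1) ->
  is_derive u 1 (fun s => f (pt t s)) (pd 1 f (pt t u)).
Proof.
move=> /derivableP.
have := @is_derive_line _ _ f (pt t 0) (delta_mx 0 1) u.
rewrite pt_line add0r => h /h.
by rewrite (_ : (fun _ => _) = (fun s => f (pt t s))) //; apply/funext => s;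
  rewrite pt_line add0r.
Qed.

(** By the intermediate value theorem. It keeps a flow line on its sheet of the two-sheeted
    hyperboloid. *)
Lemma derivable_neq0_gt0 (f : R -> R) : (forall s, derivable f s 1) ->
  (forall s, f s != 0) -> 0 < f 0 -> forall s, 0 < f s.
Proof.
move=> df f0 fpos s; rewrite ltNge; apply/negP => fs.
have cf (i j : R) : {within `[i, j], continuous f}.
  by apply: continuous_subspaceT => x; exact/differentiable_continuous/derivable1_diffP.
have [s0|s0] := leP 0 s.
  have [|c _ c0] := IVT s0 (cf 0 s) (v := 0).
    by rewrite ge_min fs orbT le_max (ltW fpos).
  by have := f0 c; rewrite c0 eqxx.
have [|c _ c0] := IVT (ltW s0) (cf s 0) (v := 0).
  by rewrite ge_min fs le_max (ltW fpos) orbT.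
by have := f0 c; rewrite c0 eqxx.
Qed.

(* If N^3 = lam N, then exp(tN) = 1 + s(t) N + c(t) N^2. *)
Lemma exp_coefs (lam : R) : exists s c : R -> R,
  [/\ s 0 = 0 /\ c 0 = 0, forall t : R, is_derive t 1 s (1 + lam * c t),
      forall t : R, is_derive t 1 c (s t)
    & forall t, s t ^+ 2 = 2 * c t + lam * c t ^+ 2].
Proof.
have [->|l0] := eqVneq lam 0.
  exists id, (fun t => 2^-1 * (t * t)); split.
  - by rewrite mul0r mulr0.
  - by move=> t; rewrite mul0r addr0; exact: is_derive_id.
  - move=> t; have h := is_derive_id t (1 : R).
    by apply: is_derive_eq (is_derive_scale 2^-1 (is_derive_mul h h)) _; field.
  - by move=> t; field.
(* For lam nonzero, s = si(wt)/w and c = (co(wt) - 1)/lam with w = sqrt |lam|; the functions are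
   circular exactly when lam < 0. *)
pose circ := lam < 0; pose w : R := Num.sqrt `|lam|.
have w0 : w != 0 by rewrite sqrtr_eq0 -ltNge normr_gt0.
have lamE : lam = ang R circ * w ^+ 2.
  rewrite sqr_sqrtr // /ang /circ; case: ltP => h; first by rewrite ltr0_norm //; ring.
  by rewrite ger0_norm // mul1r.
have aa := angM R circ.
have a0 : ang R circ != 0 by apply/eqP => a0; move: aa; rewrite a0 mul0r => /eqP;
  rewrite eq_sym oner_eq0.
have dw (t : R) : is_derive t 1 (fun x => w * x) w.
  by apply: is_derive_eq (is_derive_scale w (is_derive_id t (1 : R))) _; rewrite mulr1.
have dsi (t : R) := is_derive1_comp (is_derive_si circ (w * t)) (dw t).
have dco (t : R) := is_derive1_comp (is_derive_co circ (w * t)) (dw t).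
exists (fun t => w^-1 * si circ (w * t)),
  (fun t => lam^-1 * (co circ (w * t) + -1)); split.
- by rewrite mulr0 si0 co0 mulr0 subrr mulr0.
- move=> t; apply: is_derive_eq (is_derive_scale _ (dsi t)) _.
  by rewrite mulVKf // mulrCA mulVf // mulr1 addrC subrK.
- move=> t; have dc := is_derive_add (dco t) (is_derive_cst (-1 : R) t (1 : R)).
  apply: is_derive_eq (is_derive_scale lam^-1 dc) _.
  by rewrite lamE; field; rewrite w0 a0.
(* This is co^2 = 1 + ang si^2 rewritten through co = 1 + lam c and si = w s. It is the identity by
   which exp(tN) preserves the quadratic form. *)
- move=> t; have := co2si2 circ (w * t).
  rewrite lamE; move: (co _ _) (si _ _) aa a0 => x y.
  move: (ang R circ) => a aa a0 xy.
  by field : aa xy; rewrite w0 a0.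
Qed.

End Lines.

(* The plane is mapped to r (ch t co u a + ch t si u b + sh t c), where a, b, c
   is an orthogonal basis of the ambient space with squares -e1, ang e1, e1. The
   induced metric is r^2 e1 (dt^2 + ang ch^2 t du^2). *)

Section Model.
Variables (R : realType) (circ : bool) (e1 r : R).
Variables (K : 'M[R]_3) (a b c : 'rV[R]_3) (pts : set 'rV[R]_3).

Local Notation plane := 'rV[R]_2.
Local Notation space := 'rV[R]_3.
Local Notation e := (ang R circ).
Local Notation M := (Surface K pts).
Local Notation ev := (@ev R circ).

Definition form (x y : space) : R := (x *m K *m y^T) 0 0.

Definition emb (y0 y1 y2 : R) : space :=
  (r * y0) *: a + (r * y1) *: b + (r * y2) *: c.

Hypothesis e1M : e1 * e1 = 1.
Hypothesis r0 : r != 0.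
Hypothesis faa : form a a = - e1.
Hypothesis fbb : form b b = e * e1.
Hypothesis fcc : form c c = e1.
Hypothesis fab : form a b = 0 /\ form b a = 0.
Hypothesis fac : form a c = 0 /\ form c a = 0.
Hypothesis fbc : form b c = 0 /\ form c b = 0.
(** For e = 1 the quadric has two sheets and the sign of y0 selects one; for e = -1 it is
    connected. *)
Hypothesis ptsE : forall o, pts o <-> exists y0 y1 y2 : R,
  [/\ - y0 ^+ 2 + e * y1 ^+ 2 + y2 ^+ 2 = -1, e = 1 -> 0 < y0
    & o = emb y0 y1 y2].

Lemma ang_neq0 : e != 0.
Proof.
by apply/eqP => h; have := angM R circ; rewrite h mul0r => /eqP;
  rewrite eq_sym oner_eq0.
Qed.

Lemma e1_neq0 : e1 != 0.
Proof.
by apply/eqP => h; move: e1M; rewrite h mul0r => /eqP; rewrite eq_sym oner_eq0.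
Qed.

Lemma form_lin k x y z : (form (k *: x + y) z = k * form x z + form y z) *
  (form z (k *: x + y) = k * form z x + form z y).
Proof.
rewrite /form !mulmxDl linearD /= mulmxDr -!scalemxAl linearZ /= -!scalemxAr.
by split; rewrite addmxE scalemxE.
Qed.

Lemma form_emb y0 y1 y2 z0 z1 z2 : form (emb y0 y1 y2) (emb z0 z1 z2) =
  r ^+ 2 * e1 * (- (y0 * z0) + e * y1 * z1 + y2 * z2).
Proof.
have fZ k x z : (form (k *: x) z = k * form x z) * (form z (k *: x) = k * form z x).
  by rewrite /form linearZ /= -!scalemxAl -!scalemxAr; split; rewrite scalemxE.
rewrite /emb -!addrA !form_lin !fZ faa fbb fcc fab.1 fab.2 fac.1 fac.2 fbc.1 fbc.2.
by ring.
Qed.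

(** The vectors a, b, c are orthogonal with nonzero squares, so pairing with them recovers the
    coordinates. *)
Lemma emb_inj y0 y1 y2 z0 z1 z2 : emb y0 y1 y2 = emb z0 z1 z2 ->
  [/\ y0 = z0, y1 = z1 & y2 = z2].
Proof.
move=> E.
have k0 : r ^+ 2 * e1 != 0 by rewrite mulf_neq0 ?e1_neq0 // expf_neq0.
have F w0 w1 w2 : - (y0 * w0) + e * y1 * w1 + y2 * w2 =
    - (z0 * w0) + e * z1 * w1 + z2 * w2.
  by apply: (mulfI k0); rewrite -!form_emb E.
split.
- by have := F 1 0 0; lra.
- have := F 0 1 0; rewrite !mulr0 !mulr1 oppr0 !add0r !addr0.
  exact: (mulfI ang_neq0).
- by have := F 0 0 1; lra.
Qed.

Local Notation Y0 := (Mul Ch Co).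
Local Notation Y1 := (Mul Ch Si).

Definition sigma_expr (j : 'I_3) : expr R :=
  Add (Mul (Cst (r * a 0 j)) Y0)
    (Add (Mul (Cst (r * b 0 j)) Y1) (Mul (Cst (r * c 0 j)) Sh)).

Definition sigma : plane -> space := row_ev circ sigma_expr.

Lemma sigmaE p : sigma p = emb (ch (p 0 0) * co circ (p 0 1))
  (ch (p 0 0) * si circ (p 0 1)) (sh (p 0 0)).
Proof. by apply/rowP => j; rewrite !mxE /=; ring. Qed.

Lemma derive_sigma p v : 'D_v sigma p =
  emb (v 0 0 * sh (p 0 0) * co circ (p 0 1)
       + v 0 1 * ch (p 0 0) * e * si circ (p 0 1))
      (v 0 0 * sh (p 0 0) * si circ (p 0 1)
       + v 0 1 * ch (p 0 0) * co circ (p 0 1))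
      (v 0 0 * ch (p 0 0)).
Proof. by rewrite derive_row_ev; apply/rowP => j; rewrite !mxE /=; ring. Qed.

Lemma is_derive_sigma p v : is_derive p v sigma ('D_v sigma p).
Proof.
by apply/derivableP/derivable_mxP => i j; rewrite (_ : (fun _ => _) = ev (sigma_expr j));
  [have [] := is_derive_ev circ (sigma_expr j) p v
  |apply/funext => q; rewrite mxE].
Qed.

(** * Curvature of the induced metric *)

Local Notation G := (induced_metric M sigma).

Lemma metricE p : G p = mx2 (r ^+ 2 * e1) 0 0 (r ^+ 2 * e1 * e * ch (p 0 0) ^+ 2).
Proof.
have h := co2si2 circ (p 0 1); have ee := angM R circ; have h' := ch2sh2 (p 0 0).
apply/matrixP => i j; rewrite mxE -/(form _ _) !derive_sigma form_emb.
elim/ord2P: i; elim/ord2P: j; rewrite !mxE /=;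
 move: (co _ _) (si _ _) (ch _) (sh _) (ang _ _) h ee h' => C S x y ep h ee h';
 ring : h ee h'.
Qed.

Lemma invmx_diag (x y : R) : x != 0 -> y != 0 ->
  (invmx (mx2 x 0 0 y) = mx2 x^-1 0 0 y^-1) * (mx2 x 0 0 y \in unitmx).
Proof.
move=> x0 y0.
have E : mx2 x 0 0 y *m mx2 x^-1 0 0 y^-1 = 1%:M.
  by rewrite mx2_mul mx2_id; congr mx2; field.
have [U _] := mulmx1_unit E.
by split=> //; rewrite -[LHS]mulmx1 -E mulKmx.
Qed.

Lemma diag_quadratic (x y : R) (u w : plane) :
  (u *m mx2 x 0 0 y *m w^T) 0 0 = x * u 0 0 * w 0 0 + y * u 0 1 * w 0 1.
Proof. by rewrite !mxE !sum2 !mxE !sum2 !mx2E; ring. Qed.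

Lemma rr_neq0 : r ^+ 2 * e1 != 0.
Proof. by rewrite mulf_neq0 ?e1_neq0 // expf_neq0. Qed.

Lemma gg_neq0 t : r ^+ 2 * e1 * e * ch t ^+ 2 != 0.
Proof. by rewrite mulf_neq0 ?expf_neq0 ?ch_neq0 // mulf_neq0 ?ang_neq0 ?rr_neq0. Qed.

Lemma metric_unit p : G p \in unitmx.
Proof. by rewrite metricE invmx_diag ?rr_neq0 ?gg_neq0. Qed.

Lemma metric_inv p : invmx (G p) =
  mx2 (r ^+ 2 * e1)^-1 0 0 (r ^+ 2 * e1 * e * ch (p 0 0) ^+ 2)^-1.
Proof. by rewrite metricE invmx_diag ?rr_neq0 ?gg_neq0. Qed.

Lemma pd_metric k p :
  (pd k (fun x => G x 0 0) p = 0) * (pd k (fun x => G x 0 1) p = 0) *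
  (pd k (fun x => G x 1 0) p = 0) *
  (pd k (fun x => G x 1 1) p =
   if k == 0 then 2 * (r ^+ 2 * e1 * e) * ch (p 0 0) * sh (p 0 0) else 0).
Proof.
have E i j x : (forall q, G q i j = ev x q) -> pd k (fun q => G q i j) p = ev (pdx circ k x) p.
  by move=> h; rewrite (_ : (fun _ => _) = ev x) ?pd_ev //; exact/funext.
rewrite (E 0 0 (Cst (r ^+ 2 * e1))); last by move=> q; rewrite metricE mxE.
rewrite (E 0 1 (Cst 0)); last by move=> q; rewrite metricE mxE.
rewrite (E 1 0 (Cst 0)); last by move=> q; rewrite metricE mxE.
rewrite (E 1 1 (Mul (Cst (r ^+ 2 * e1 * e)) (Mul Ch Ch))); last first.
  by move=> q; rewrite metricE mxE /= expr2.
by split; [split; [split|]|] => //; elim/ord2P: k {E}; rewrite /=; ring.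
Qed.

(** Indices 0 and 1 stand for t and u. The constant factor r^2 e1 of the metric cancels from the
    symbols. *)
Definition christoffel_expr (k i j : 'I_2) : expr R :=
  if k == 0 then (if (i == 1) && (j == 1) then Mul (Cst (- e)) (Mul Ch Sh)
                  else Cst 0)
  else if i == j then Cst 0 else Th.

Lemma christoffelE k i j : christoffel G k i j = ev (christoffel_expr k i j).
Proof.
apply/funext => p; rewrite /christoffel sum2 metric_inv.
elim/ord2P: k; elim/ord2P: i; elim/ord2P: j;
  rewrite /christoffel_expr !pd_metric !mxE /= /th;
  have := ch_neq0 (p 0 0); move: r0 e1_neq0 ang_neq0;
  move: (ch (p 0 0)) (sh (p 0 0)) (ang R circ) => x y ep h1 h2 h3 h4;
  by field; rewrite ?h1 ?h2 ?h3 ?h4.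
Qed.

(** Thus Ric = - G / (r^2 e1): the Gaussian curvature is -1 / (r^2 e1), which equals - e1 / r^2
    because e1 is a sign. *)
Lemma ricciE p : (ricci G 0 0 p = -1) * (ricci G 0 1 p = 0) * (ricci G 1 0 p = 0)
  * (ricci G 1 1 p = - e * ch (p 0 0) ^+ 2).
Proof.
have h := th_ch (p 0 0); have h' := ch2sh2 (p 0 0).
have := christoffelE; rewrite /ricci; move: (christoffel G) => Gamma GammaE.
rewrite !sum2 !GammaE !pd_ev /=.
by split; [split; [split|]|]; ring : h.
Qed.

Lemma scalar_curvatureE p : scalar_curvature G p = - 2 * e1 / r ^+ 2.
Proof.
rewrite /scalar_curvature !sum2 !ricciE metric_inv !mx2E.
have := ch_neq0 (p 0 0); move: r0 e1_neq0 ang_neq0 e1M.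
move: (ch (p 0 0)) (ang R circ) => x ep h1 h2 h3 h4 h5.
have e1V : e1^-1 = e1 by apply: (mulfI h2); rewrite mulfV // h4.
transitivity (- 2 * e1^-1 / r ^+ 2); last by rewrite e1V.
by field; rewrite ?h1 ?h2 ?h3 ?h5.
Qed.

(** * Killing fields *)

Lemma lie_derivativeE (X : plane -> plane) p :
  (lie_derivative G X 0 0 p =
    2 * (r ^+ 2 * e1) * pd 0 (fun x => X x 0 0) p) *
  (lie_derivative G X 0 1 p = r ^+ 2 * e1 *
    (pd 1 (fun x => X x 0 0) p + e * ch (p 0 0) ^+ 2 * pd 0 (fun x => X x 0 1) p)) *
  (lie_derivative G X 1 0 p = r ^+ 2 * e1 *
    (pd 1 (fun x => X x 0 0) p + e * ch (p 0 0) ^+ 2 * pd 0 (fun x => X x 0 1) p)) *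
  (lie_derivative G X 1 1 p = 2 * (r ^+ 2 * e1 * e) * ch (p 0 0) *
    (sh (p 0 0) * X p 0 0 + ch (p 0 0) * pd 1 (fun x => X x 0 1) p)).
Proof.
have := metricE p; have := fun k => pd_metric k p; move: G => H dHE HE.
rewrite /lie_derivative !sum2 !dHE !HE !mx2E.
move: (pd 0 _ p) (pd 1 _ p) (pd 0 _ p) (pd 1 _ p) => u v w z.
by rewrite /=; split; [split; [split|]|]; ring.
Qed.

(* The coefficients are those of d_u, co u d_t - th t si u d_u and
   si u d_t - ang th t co u d_u. *)
Definition killing_expr (k : 'I_3 -> R) (j : 'I_2) : expr R :=
  if j == 0 then Add (Mul (Cst (k 1)) Co) (Mul (Cst (k 2)) Si)
  else Add (Cst (k 0))
    (Mul (Mul (Cst (-1)) Th) (Add (Mul (Cst (k 1)) Si) (Mul (Cst (e * k 2)) Co))).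

Definition killing_field k : plane -> plane := row_ev circ (killing_expr k).

Lemma killing_fieldE k p :
  (killing_field k p 0 0 = k 1 * co circ (p 0 1) + k 2 * si circ (p 0 1)) *
  (killing_field k p 0 1 = k 0 - th (p 0 0) *
     (k 1 * si circ (p 0 1) + e * k 2 * co circ (p 0 1))).
Proof. by rewrite !mxE /=; split=> //; ring. Qed.

Lemma derive_killing_field k p v : 'D_v (killing_field k) p = row_ev circ (fun j => ddx circ v (killing_expr k j)) p.
Proof. exact: derive_row_ev. Qed.

(** In the coordinates (y0, y1, y2) the field is a linear map N, skew for diag(-1, e, 1). As p
    enters only through the point [sigma p], the field descends to the surface even when [sigma] is
    periodic. *)
Lemma derive_sigma_killing_field k (p : plane) (y0 := ch (p 0 0) * co circ (p 0 1))
    (y1 := ch (p 0 0) * si circ (p 0 1)) (y2 := sh (p 0 0)) :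
  'D_(killing_field k p) sigma p = emb (e * k 0 * y1 + k 1 * y2) (k 0 * y0 - e * k 2 * y2)
    (k 1 * y0 + k 2 * y1).
Proof.
rewrite derive_sigma !killing_fieldE /y0 /y1 /y2.
have h := th_ch (p 0 0); have h' := co2si2 circ (p 0 1); have h'' := angM R circ.
move: (th _) (ch _) (sh _) (co _ _) (si _ _) (ang _ _) h h' h'' => T x y C S ep h h' h''.
by congr emb; ring : h h' h''.
Qed.

Lemma killing_killing_field k : killing M sigma (killing_field k).
Proof.
split.
  split; first exact: smooth_row_ev.
  move=> p p'; rewrite !sigmaE => /emb_inj[h0 h1 h2].
  by rewrite !derive_sigma_killing_field h0 h1 h2.
have pdE i j p : pd i (fun x => killing_field k x 0 j) p = ev (pdx circ i (killing_expr k j)) p.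
  rewrite (_ : (fun x => _) = ev (killing_expr k j)); first exact: pd_ev.
  by apply/funext => q; rewrite mxE.
elim/ord2P; elim/ord2P => p; rewrite lie_derivativeE ?pdE /=;
 have h := th2_ch2 (p 0 0); have h' := th_ch (p 0 0); have h'' := angM R circ;
 rewrite ?killing_fieldE;
 move: (th (p 0 0)) (ch (p 0 0)) (sh (p 0 0)) (co circ (p 0 1)) (si circ (p 0 1))
  (ang R circ) h h' h'' => T x y C S ep h h' h'';
 first [by ring : h h''|by ring : h' h''].
Qed.

Lemma field_bracket_killing_field (k l : 'I_3 -> R) (m := fun i : 'I_3 =>
    if i == 0 then - e * (k 1 * l 2 - k 2 * l 1)
    else if i == 1 then k 0 * l 2 - k 2 * l 0 else e * (k 0 * l 1 - k 1 * l 0)) p :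
  field_bracket (killing_field k) (killing_field l) p = killing_field m p.
Proof.
have h' := co2si2 circ (p 0 1); have h'' := angM R circ.
rewrite /field_bracket !derive_killing_field; apply: row2P;
 rewrite addmxE oppmxE !mxE /= !mxE /= /m /=;
 move: (th (p 0 0)) (co circ (p 0 1)) (si circ (p 0 1))
  (ang R circ) h' h'' => T C S ep h' h'';
 ring : h' h''.
Qed.

Lemma killing_field0 k : (killing_field k 0 0 0 = k 1) * (killing_field k 0 0 1 = k 0).
Proof. by rewrite !killing_fieldE !mx0E co0 si0 th0; split; ring. Qed.

Lemma killing_field_inj k : (forall p, killing_field k p = 0) -> forall i, k i = 0.
Proof.
move=> h; have := h 0 => /rowP /[dup] /(_ 0) + /(_ 1).
rewrite !killing_field0 !mxE => k1 k0.
(* The field of [k 2] vanishes at the origin, so a point with th t nonzero is needed to detect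
   it. *)
have [t st] := sh_surj (1 : R).
have := congr1 (fun w : plane => w 0 1) (h (pt t 0)).
rewrite killing_fieldE !ptE co0 si0 k0 k1 mx0E => k2.
have tn0 : th t != 0 by rewrite /th st mul1r invr_neq0 // ch_neq0.
have {}k2 : k 2 = 0.
  apply: (mulfI (mulf_neq0 tn0 ang_neq0)); lra.
case=> [[|[|[|//]]] i]; [rewrite -[RHS]k0|rewrite -[RHS]k1|rewrite -[RHS]k2];
  congr k; exact: val_inj.
Qed.

Lemma oscillator (f g : R -> R) : (forall u : R, is_derive u 1 f (g u)) ->
  (forall u : R, is_derive u 1 g (e * f u)) -> forall u : R,
  f u = f 0 * co circ u + g 0 * si circ u /\
  g u = e * f 0 * si circ u + g 0 * co circ u.
Proof.
move=> df dg u.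
(* [A] and [B] apply to (f, g) the inverse of the flow matrix ((co, si), (e si, co)), whose
   determinant is 1; they are constant, and inverting again recovers f and g. *)
pose A := fun u => f u * co circ u + - 1 * (g u * si circ u).
pose B := fun u => g u * co circ u + - e * (f u * si circ u).
have ee := angM R circ.
have hA : A u = A 0.
  apply: is_derive_0_is_cst => x.
  have d1 := is_derive_mul (df x) (is_derive_co circ x).
  have d2 := is_derive_mul (dg x) (is_derive_si circ x).
  by apply: is_derive_eq (is_derive_add d1 (is_derive_scale (-1) d2)) _; ring.
have hB : B u = B 0.
  apply: is_derive_0_is_cst => x.
  have d1 := is_derive_mul (dg x) (is_derive_co circ x).
  have d2 := is_derive_mul (df x) (is_derive_si circ x).
  by apply: is_derive_eq (is_derive_add d1 (is_derive_scale (- e) d2)) _; ring.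
move: hA hB; rewrite /A /B co0 si0 => hA hB.
have h := co2si2 circ u.
have {}hA : f u * co circ u - g u * si circ u = f 0 by rewrite -[RHS]mulr1; lra.
have {}hB : g u * co circ u - e * f u * si circ u = g 0.
  rewrite -[RHS]mulr1; move: hB; rewrite mulr0 mulr0 addr0 => <-; ring.
by split; rewrite -hA -hB; move: (co circ u) (si circ u) (f u) (g u) (ang R circ) h ee
  => C S x y ep h ee; ring : h ee.
Qed.

(* The (t, t) equation makes the t-component a function f(u); the (t, u) equation
   then gives the u-component as c(u) - ang f'(u) th t, and the (u, u) equation
   forces c' = 0 and f'' = ang f. *)
Lemma killing_unique X : killing M sigma X -> exists k, forall p, X p = killing_field k p.
Proof.
move=> [[/(_ 1%N) /= [dX _] _] kX].
pose X0 (p : plane) : R := X p 0 0; pose X1 (p : plane) : R := X p 0 1.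
have dX0 p v : derivable X0 p v.
  have d : derivable X p v by exact: diff_derivable.
  by have /derivable_mxP /(_ 0 0) := d.
have dX1 p v : derivable X1 p v.
  have d : derivable X p v by exact: diff_derivable.
  by have /derivable_mxP /(_ 0 1) := d.
have E00 p : pd 0 X0 p = 0.
  have /eqP := kX 0 0 p; rewrite lie_derivativeE mulf_eq0 mulf_eq0.
  by rewrite (negbTE rr_neq0) orbF pnatr_eq0 /= => /eqP.
have E01 p : pd 0 X1 p = - e * (1 - th (p 0 0) ^+ 2) * pd 1 X0 p.
  have /eqP := kX 0 1 p; rewrite lie_derivativeE mulf_eq0 (negbTE rr_neq0) /=.
  rewrite -/X0 -/X1 => /eqP h.
  apply: (mulfI (expf_neq0 2 (ch_neq0 (p 0 0)))).
  apply: (mulfI ang_neq0).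
  have h' := th2_ch2 (p 0 0); have ee := angM R circ.
  move: h h' ee; move: (pd 0 X1 p) (pd 1 X0 p) (th _) (ch _) (ang _ _) => u v T x ep h h' ee.
  have -> : ep * (x ^+ 2 * u) = v + ep * x ^+ 2 * u - v by ring.
  by rewrite h; ring : h' ee.
have E11 p : pd 1 X1 p = - th (p 0 0) * X0 p.
  have /eqP := kX 1 1 p; rewrite lie_derivativeE mulf_eq0 -/X0 -/X1.
  rewrite (negbTE (mulf_neq0 _ (ch_neq0 _))) /=; last first.
    by apply: mulf_neq0 (mulf_neq0 rr_neq0 ang_neq0); rewrite pnatr_eq0.
  move=> /eqP h; apply: (mulfI (ch_neq0 (p 0 0))).
  have h' := th_ch (p 0 0); move: h; rewrite -[X p 0 0]/(X0 p) -h' => h.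
  by apply/eqP; rewrite -subr_eq0 -[X in _ == X]h; apply/eqP; ring.
have X0E t u : X0 (pt t u) = X0 (pt 0 u).
  apply: (@is_derive_0_is_cst _ (fun s => X0 (pt s u))) => s.
  by have := is_derive_slice0 (dX0 (pt s u) (delta_mx 0 0)); rewrite E00.
pose f (u : R) : R := X0 (pt 0 u); pose A (u : R) : R := pd 1 X0 (pt 0 u).
have df (u : R) : is_derive u 1 f (A u) by exact: is_derive_slice1.
have AE t u : pd 1 X0 (pt t u) = A u.
  apply: (is_derive_unique _ (df u)).
  have := is_derive_slice1 (dX0 (pt t u) (delta_mx 0 1)).
  by rewrite (_ : (fun _ => _) = f) //; apply/funext => s; rewrite X0E.
have X1E t u : X1 (pt t u) = X1 (pt 0 u) - e * A u * th t.
  have h : X1 (pt t u) + e * A u * th t = X1 (pt 0 u) + e * A u * th 0.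
    apply: (@is_derive_0_is_cst _ (fun s => X1 (pt s u) + e * A u * th s)) => s.
    have d := is_derive_slice0 (dX1 (pt s u) (delta_mx 0 0)).
    apply: is_derive_eq (is_derive_add d (is_derive_scale _ (is_derive_th s))) _.
    by rewrite E01 AE ptE; ring.
  by move: h; rewrite th0; lra.
have X1c u : X1 (pt 0 u) = X1 (pt 0 0).
  apply: (@is_derive_0_is_cst _ (fun s => X1 (pt 0 s))) => s.
  by have := is_derive_slice1 (dX1 (pt 0 s) (delta_mx 0 1));
    rewrite E11 ptE th0 oppr0 mul0r.
have [t st] := sh_surj (1 : R).
have tn0 : th t != 0 by rewrite /th st mul1r invr_neq0 // ch_neq0.
have ee := angM R circ.
pose c0 := X1 (pt 0 0).
(* [A] is itself a derivative, and only first derivatives of X are at hand. Solving [X1E] for [A] at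
   a fixed t with th t nonzero expresses it through X1, which is differentiable. *)
have dA (u : R) : is_derive u 1 A (e * f u).
  have -> : A = fun u : R => e / th t * c0 + - (e / th t) * X1 (pt t u).
    apply/funext => s; rewrite X1E X1c -/c0.
    by move: tn0 ang_neq0 ee; move: (A s) (th t) (ang _ _) => x T ep T0 h0 ee;
      field : ee.
  have d := is_derive_slice1 (dX1 (pt t u) (delta_mx 0 1)).
  apply: is_derive_eq (is_derive_add (is_derive_cst _ u (1 : R)) (is_derive_scale _ d)) _.
  by rewrite E11 ptE X0E -/(f u); field.
exists (fun i => if i == 0 then c0 else if i == 1 then f 0 else A 0) => p.
rewrite [p]pt_eta; move: (p 0 0) (p 0 1) => s u.
have [fE gE] := oscillator df dA u.
apply: row2P; rewrite killing_fieldE !ptE /= -?[X _ 0 0]/(X0 _) -?[X _ 0 1]/(X1 _).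
  by rewrite X0E -/(f u) fE.
rewrite X1E X1c -/c0 gE.
by move: (ang R circ) ee => ep ee; ring : ee.
Qed.

Lemma maximally_symmetric_model : maximally_symmetric M sigma.
Proof.
exists (fun i => killing_field (fun j => (i == j)%:R)).
have E k p : \sum_i k i *: killing_field (fun j => (i == j)%:R) p = killing_field k p.
  rewrite sum3.
  by apply: row2P; rewrite !(addmxE, scalemxE) !killing_fieldE /=; ring.
split.
- by move=> i; exact: killing_killing_field.
- by move=> X /killing_unique[k kE]; exists k => p; rewrite kE E.
- by move=> k h; apply: killing_field_inj => p; rewrite -E h.
Qed.

Lemma parametrises_model : parametrises M sigma.
Proof.
split; [exact: smooth_row_ev| |exact: metric_unit].
apply/seteqP; split=> [_ [p _ <-]|o /ptsE[y0 [y1 [y2 [q pos ->]]]]].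
  apply/ptsE; rewrite sigmaE; do 3 eexists; split; last by [].
    have h := co2si2 circ (p 0 1); have h' := ch2sh2 (p 0 0).
    by move: (co _ _) (si _ _) (ch _) (sh _) h h' => C S x y h h'; ring : h h'.
  by move=> /co_gt0 h; rewrite mulr_gt0 ?ch_gt0.
(* The third coordinate fixes t; division by ch t then moves (y0, y1) to the unit conic, where u is
   found. *)
have [t st] := sh_surj y2; have cn := ch_neq0 t.
have [||u [cu su]] := @co_si_surj R circ (y0 / ch t) (y1 / ch t).
- have h := ch2sh2 t; rewrite st in h.
  have -> : (y0 / ch t) ^+ 2 = y0 ^+ 2 / ch t ^+ 2 by field.
  have -> : 1 + e * (y1 / ch t) ^+ 2 = (ch t ^+ 2 + e * y1 ^+ 2) / ch t ^+ 2.
    by field.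
  by congr (_ / _); rewrite h; lra.
- by move=> /pos y0p; rewrite divr_gt0 ?ch_gt0.
exists (pt t u) => //; rewrite sigmaE !ptE cu su st.
by rewrite ![ch t * _]mulrC !divfK.
Qed.

(** * Flows of the Killing fields *)

Lemma is_derive_emb (y0 y1 y2 : R -> R) (t d0 d1 d2 : R) :
  is_derive t 1 y0 d0 -> is_derive t 1 y1 d1 -> is_derive t 1 y2 d2 ->
  is_derive t 1 (fun s => emb (y0 s) (y1 s) (y2 s)) (emb d0 d1 d2).
Proof.
move=> h0 h1 h2; apply: is_derive_mx => i j.
have D := is_derive_add (is_derive_add (is_derive_scale (r * a i j) h0)
  (is_derive_scale (r * b i j) h1)) (is_derive_scale (r * c i j) h2).
rewrite (_ : (fun _ => _) = (fun s => r * a i j * y0 s + r * b i j * y1 s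
   + r * c i j * y2 s)); last by apply/funext => s; rewrite !mxE; ring.
by apply: is_derive_eq D _; rewrite !mxE; ring.
Qed.

Lemma integral_curve_killing_field k (o : space) : pts o ->
  exists2 gam : R -> space, gam 0 = o & integral_curve sigma (killing_field k) gam.
Proof.
move=> /ptsE[y0 [y1 [y2 [q pos ->]]]].
(* The field is the restriction of a linear field N of the ambient space, and
   N^3 = lam N. *)
pose lam := e * k 0 ^+ 2 + k 1 ^+ 2 - e * k 2 ^+ 2.
have [s [cc [[s0 c0] ds dc sc]]] := exp_coefs lam.
pose N0 (x y z : R) := e * k 0 * y + k 1 * z.
pose N1 (x y z : R) := k 0 * x - e * k 2 * z.
pose N2 (x y z : R) := k 1 * x + k 2 * y.
pose v0 := N0 y0 y1 y2; pose v1 := N1 y0 y1 y2; pose v2 := N2 y0 y1 y2.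
(* The curve is exp(tN) y = y + s N y + c N^2 y, with v = N y. As N is traceless and singular,
   Cayley-Hamilton gives N^3 = lam N with [lam] half the trace of N^2. *)
pose z0 t := y0 + (v0 * s t + N0 v0 v1 v2 * cc t).
pose z1 t := y1 + (v1 * s t + N1 v0 v1 v2 * cc t).
pose z2 t := y2 + (v2 * s t + N2 v0 v1 v2 * cc t).
have dz (y v w t : R) : is_derive t 1 (fun t => y + (v * s t + w * cc t))
    (v * (1 + lam * cc t) + w * s t).
  have D := is_derive_add (is_derive_cst y t (1 : R))
    (is_derive_add (is_derive_scale v (ds t)) (is_derive_scale w (dc t))).
  by apply: is_derive_eq D _; rewrite add0r.
have ee := angM R circ.
have Q t : - z0 t ^+ 2 + e * z1 t ^+ 2 + z2 t ^+ 2 = -1.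
  rewrite -q /z0 /z1 /z2 /v0 /v1 /v2 /N0 /N1 /N2.
  have := sc t; rewrite /lam; move: (s t) (cc t) => S C.
  move: (k 0) (k 1) (k 2) (ang R circ) ee => k0 k1 k2 ep ee h.
  by ring : h ee.
(* For e = 1 the equation [Q] excludes z0 = 0, so z0 keeps its initial sign. *)
have pz t : e = 1 -> 0 < z0 t.
  move=> e1E; apply: derivable_neq0_gt0 => [u|u|].
  - by have [] := dz y0 v0 (N0 v0 v1 v2) u.
  - apply/eqP => h; have := Q u; rewrite h e1E.
    by have := sqr_ge0 (z1 u); have := sqr_ge0 (z2 u); lra.
  - by rewrite /z0 s0 c0 !mulr0 !addr0; exact: pos.
have [_ rng _] := parametrises_model.
exists (fun t => emb (z0 t) (z1 t) (z2 t)).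
  by rewrite /z0 /z1 /z2 s0 c0 !mulr0 !addr0.
move=> t.
(* An integral curve must name a parameter point over each of its points; surjectivity of [sigma]
   supplies it. *)
have : pts (emb (z0 t) (z1 t) (z2 t)).
  apply/ptsE; exists (z0 t), (z1 t), (z2 t).
  by split; [exact: Q|exact: pz|].
rewrite -[pts _]/(points M _) -rng => -[p _ pE]; exists p; first exact: pE.
move: pE; rewrite sigmaE => /emb_inj[h0 h1 h2].
rewrite derive_sigma_killing_field h0 h1 h2.
have := is_derive_emb (dz y0 v0 (N0 v0 v1 v2) t) (dz y1 v1 (N1 v0 v1 v2) t)
  (dz y2 v2 (N2 v0 v1 v2) t).
move=> D; apply: is_derive_eq D _.
rewrite /z0 /z1 /z2 /v0 /v1 /v2 /N0 /N1 /N2 /lam; move: (s t) (cc t) => S C.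
move: (k 0) (k 1) (k 2) (ang R circ) ee => k0 k1 k2 ep ee.
by congr emb; ring : ee.
Qed.

(** Serves the coordinate lines, which suffice to join any two points of the surface. *)
Lemma integral_curve_line k (p v : plane) :
  (forall s : R, killing_field k (p + s *: v) = v) ->
  integral_curve sigma (killing_field k) (fun s => sigma (p + s *: v)).
Proof.
move=> h s; exists (p + s *: v); first by [].
apply: is_derive_line.
by rewrite h; exact: is_derive_sigma.
Qed.

(** * Transfer to an abstract Lie algebra with the bracket of the Killing fields *)

Section Homogeneous.
Variables (g : vectType R) (br : g -> g -> g) (h : g -> Prop) (q : g -> g -> R).
Variable killing_coef : g -> 'I_3 -> R.
Hypothesis al_lin : forall x y z i, killing_coef (x *: y + z) i = x * killing_coef y i + killing_coef z i.
Hypothesis al_inj : forall x, (forall i, killing_coef x i = 0) -> x = 0.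
Hypothesis al_surj : forall k, exists x, killing_coef x = k.
Hypothesis al_br : forall x y,
  [/\ killing_coef (br x y) 0 = - e * (killing_coef x 1 * killing_coef y 2 - killing_coef x 2 * killing_coef y 1),
      killing_coef (br x y) 1 = killing_coef x 0 * killing_coef y 2 - killing_coef x 2 * killing_coef y 0
    & killing_coef (br x y) 2 = e * (killing_coef x 0 * killing_coef y 1 - killing_coef x 1 * killing_coef y 0)].
Hypothesis al_h : forall x, h x <-> killing_coef x 0 = 0 /\ killing_coef x 1 = 0.
Hypothesis al_q : forall x y,
  q x y = r ^+ 2 * e1 * (killing_coef x 1 * killing_coef y 1 + e * (killing_coef x 0 * killing_coef y 0)).

Let Phi x := killing_field (killing_coef x).

Lemma isometric_action_model : isometric_action M sigma br Phi.
Proof.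
split.
- move=> x y z p; apply: row2P; rewrite addmxE scalemxE !killing_fieldE !al_lin; ring.
- move=> x y p; rewrite field_bracket_killing_field; have [b0 b1 b2] := al_br x y.
  by apply: row2P; rewrite !killing_fieldE /= ?b0 ?b1 ?b2.
- by move=> x; exact: killing_killing_field.
Qed.

Lemma symmetric_surface_model :
  isometry_algebra_of_symmetric_surface br h q M (- 2 * e1 / r ^+ 2).
Proof.
exists sigma; split.
- exact: parametrises_model.
- exact: maximally_symmetric_model.
- exact: scalar_curvatureE.
exists Phi; split; split.
- exact: isometric_action_model.
- by move=> x hx; apply: al_inj; exact: killing_field_inj.
- move=> X /killing_unique[k kE]; have [x xE] := al_surj k.
  by exists x => p; rewrite kE /Phi xE.
- exact: isometric_action_model.
- by move=> x o oM; exact: integral_curve_killing_field.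
- move=> o o'; have [_ rng _] := parametrises_model.
  rewrite -rng => -[p _ <-] [p' _ <-].
  have flow k (p1 v : plane) t : (forall s : R, killing_field k (p1 + s *: v) = v) ->
      same_orbit sigma Phi (sigma p) (sigma p1) ->
      same_orbit sigma Phi (sigma p) (sigma (p1 + t *: v)).
    move=> kv s1; have [x xE] := al_surj k.
    apply: (@same_orbit_flow _ _ _ _ _ x (fun s => sigma (p1 + s *: v)) t).
      by rewrite /Phi xE; exact: integral_curve_line.
    by rewrite scale0r addr0.
  (* The coefficients (1, 0, 0) give d_u everywhere. *)
  have rot t u u' : same_orbit sigma Phi (sigma p) (sigma (pt t u)) ->
      same_orbit sigma Phi (sigma p) (sigma (pt t u')).
    have -> : pt t u' = pt t u + (u' - u) *: delta_mx 0 1.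
      by rewrite pt_line addrC subrK.
    apply: (flow (fun i => (i == 0)%:R)) => s; rewrite pt_line.
    by apply: row2P; rewrite killing_fieldE /= !mxE /=; ring.
  (* The coefficients (0, 1, 0) give d_t only on the line u = 0, where co = 1 and si = 0. *)
  have boost t t' : same_orbit sigma Phi (sigma p) (sigma (pt t 0)) ->
      same_orbit sigma Phi (sigma p) (sigma (pt t' 0)).
    have -> : pt t' 0 = pt t 0 + (t' - t) *: delta_mx 0 0.
      by rewrite pt_line addrC subrK.
    apply: (flow (fun i => (i == 1)%:R)) => s; rewrite pt_line.
    by apply: row2P; rewrite killing_fieldE /= !ptE co0 si0 !mxE /=; ring.
  (* Read backwards: from p along u to u = 0, then along t, then along u to p'. *)
  rewrite [p']pt_eta; apply: (rot _ 0); apply: (boost (p 0 0)).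
  by apply: (rot _ (p 0 1)); rewrite -pt_eta; exact: same_orbit_refl.
(* At the origin the field takes the value (k 1, k 0), so its stabiliser is the line of [k 2]. *)
- exists 0; split=> [x|x y].
    split=> [/al_h[x0 x1]|]; first by apply: row2P; rewrite /Phi killing_field0 mx0E.
    move=> /rowP hx; apply/al_h; move: (hx 0) (hx 1).
    by rewrite /Phi !killing_field0 !mx0E.
  rewrite al_q /metric_at metricE diag_quadratic /Phi !killing_field0 mx0E ch0; ring.
Qed.

End Homogeneous.

End Model.

(** * The hyperbolic plane, dS_2 and AdS_2 as instances *)

Section ModelSurfaces.
Variables (R : realType) (b : R).
Hypothesis b0 : b != 0.

Definition radius : R := `|2 * b|^-1.

Lemma radius_gt0 : 0 < radius.
Proof. by rewrite invr_gt0 normr_gt0 mulf_neq0 // pnatr_eq0. Qed.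

Lemma radius_neq0 : radius != 0. Proof. by rewrite gt_eqF // radius_gt0. Qed.

Lemma radius2 : radius ^+ 2 = (4 * b ^+ 2)^-1.
Proof. by rewrite exprVn real_normK ?num_real // exprMn; congr (_ * _)^-1; ring. Qed.

Local Notation d i := (delta_mx 0 i : 'rV[R]_3).

Lemma form_delta (K : 'M[R]_3) i j : form K (d i) (d j) = K i j.
Proof. by rewrite /form trmx_delta -rowE -colE !mxE. Qed.

Lemma diag3E (x y z : R) i j : diag3 x y z i j = [:: x; y; z]`_i *+ (i == j).
Proof.
rewrite /diag3 !mxE; case: eqP => [->|_]; [by rewrite !mulr1n|by rewrite !mulr0n].
Qed.

Lemma sqnorm_diag3 (x y z : R) o : sqnorm (diag3 x y z) o =
  x * o 0 0 ^+ 2 + y * o 0 1 ^+ 2 + z * o 0 2 ^+ 2.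
Proof.
rewrite /sqnorm mul_mx_diag mxE sum3 !mxE /=; ring.
Qed.

Lemma emb_delta (i j k : 'I_3) y0 y1 y2 l : emb radius (d i) (d j) (d k) y0 y1 y2 0 l =
  radius * (y0 * (l == i)%:R + y1 * (l == j)%:R + y2 * (l == k)%:R).
Proof. rewrite !mxE /=; ring. Qed.

Lemma hyperbolic_plane_points (o : 'rV[R]_3) : points (hyperbolic_plane radius) o <->
  exists y0 y1 y2, [/\ - y0 ^+ 2 + ang R false * y1 ^+ 2 + y2 ^+ 2 = -1,
    ang R false = 1 -> 0 < y0 & o = emb radius (d 0) (d 1) (d 2) y0 y1 y2].
Proof.
have r0 := radius_neq0; have rp := radius_gt0.
rewrite /= sqnorm_diag3 /ang; split=> [[h op]|[y0 [y1 [y2 [h /(_ erefl) yp ->]]]]].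
  exists (o 0 0 / radius), (o 0 1 / radius), (o 0 2 / radius); split.
  - have -> : -1 = (- radius ^+ 2) / radius ^+ 2 :> R by field.
    by rewrite -h; field.
  - by move=> _; rewrite divr_gt0.
  - by apply/rowP => l; rewrite emb_delta; case: l => [[|[|[|//]]] il] /=;
     rewrite !(mulr0, mulr1, addr0, add0r) mulrC divfK //; congr (o 0 _); exact: val_inj.
rewrite !emb_delta /= !(mulr0, mulr1, addr0, add0r) mulr_gt0 //; split=> //.
have {}h : y0 ^+ 2 = 1 + y1 ^+ 2 + y2 ^+ 2 by move: h => /=; lra.
by ring : h.
Qed.

(** The order 1, 2, 0 gives the two spacelike axes to the circle and the timelike one to sh t; the
    defining equation then changes sign, which accounts for e1 = -1. *)
Lemma de_sitter_points (o : 'rV[R]_3) : points (de_sitter radius) o <->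
  exists y0 y1 y2, [/\ - y0 ^+ 2 + ang R true * y1 ^+ 2 + y2 ^+ 2 = -1,
    ang R true = 1 -> 0 < y0 & o = emb radius (d 1) (d 2) (d 0) y0 y1 y2].
Proof.
have r0 := radius_neq0; have rp := radius_gt0.
rewrite /= sqnorm_diag3 /ang; split=> [h|[y0 [y1 [y2 [h _ ->]]]]].
  exists (o 0 1 / radius), (o 0 2 / radius), (o 0 0 / radius); split.
  - transitivity (- ((-1 * o 0 0 ^+ 2 + 1 * o 0 1 ^+ 2 + 1 * o 0 2 ^+ 2)
      / radius ^+ 2)); first by field.
    by rewrite h; field.
  - by move=> h'; exfalso; lra.
  - by apply/rowP => l; rewrite emb_delta; case: l => [[|[|[|//]]] il] /=;
     rewrite !(mulr0, mulr1, addr0, add0r) mulrC divfK //; congr (o 0 _); exact: val_inj.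
rewrite !emb_delta /= !(mulr0, mulr1, addr0, add0r).
have {}h : y0 ^+ 2 = 1 - y1 ^+ 2 + y2 ^+ 2 by move: h => /=; lra.
by ring : h.
Qed.

Lemma anti_de_sitter_points (o : 'rV[R]_3) : points (anti_de_sitter radius) o <->
  exists y0 y1 y2, [/\ - y0 ^+ 2 + ang R true * y1 ^+ 2 + y2 ^+ 2 = -1,
    ang R true = 1 -> 0 < y0 & o = emb radius (d 0) (d 1) (d 2) y0 y1 y2].
Proof.
have r0 := radius_neq0; have rp := radius_gt0.
rewrite /= sqnorm_diag3 /ang; split=> [h|[y0 [y1 [y2 [h _ ->]]]]].
  exists (o 0 0 / radius), (o 0 1 / radius), (o 0 2 / radius); split.
  - transitivity ((-1 * o 0 0 ^+ 2 + -1 * o 0 1 ^+ 2 + 1 * o 0 2 ^+ 2)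
      / radius ^+ 2); first by field.
    by rewrite h; field.
  - by move=> h'; exfalso; lra.
  - by apply/rowP => l; rewrite emb_delta; case: l => [[|[|[|//]]] il] /=;
     rewrite !(mulr0, mulr1, addr0, add0r) mulrC divfK //; congr (o 0 _); exact: val_inj.
rewrite !emb_delta /= !(mulr0, mulr1, addr0, add0r).
have {}h : y0 ^+ 2 = 1 - y1 ^+ 2 + y2 ^+ 2 by move: h => /=; lra.
by ring : h.
Qed.

Variables (sig : signature) (sB : bsign).
Local Notation g := (even_part R sig).
Local Notation br0 := (even_bracket (tilde sB b : _ -> _ -> superspace R sig)).

(* At the origin d_t and d_u have squares r^2 e1 and r^2 e1 ang, so the timelike
   vector P_0 corresponds to d_t, except on AdS_2, where it corresponds to d_u. *)
Definition ads : bool := if (sig, sB) is (Sig11, Bminus) then true else false.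

(** The coordinate fields have length r = 1 / |2b| at the origin, so the orthonormal P_mu need the
    factor 2b. The sign on L_* makes its bracket with V agree with that of the fields. *)
Definition killing_coef (x : g) (i : 'I_3) : R :=
  if i == 0 then 2 * b * (if ads then eV0 x else eV1 x)
  else if i == 1 then 2 * b * (if ads then eV1 x else eV0 x) else - eL x.

Lemma killing_coef_linear k (x y : g) i : killing_coef (k *: x + y) i = k * killing_coef x i + killing_coef y i.
Proof.
by rewrite /killing_coef !even_lin; case: (i == 0); case: (i == 1); case: ads; ring.
Qed.

Lemma twob_neq0 : 2 * b != 0.
Proof. by rewrite mulf_neq0 // pnatr_eq0. Qed.

Lemma killing_coef_injective (x : g) : (forall i, killing_coef x i = 0) -> x = 0.
Proof.
move=> h; move: (h 0) (h 1) (h 2); rewrite /killing_coef /=.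
have z (u : R) : 2 * b * u = 0 -> u = 0.
  by move=> /eqP; rewrite mulf_eq0 (negbTE twob_neq0) => /eqP.
by case: ads => /z h0 /z h1 /eqP; rewrite oppr_eq0 => /eqP h2;
  apply: even_ext; rewrite even0.
Qed.

Lemma killing_coef_surjective k : exists x, killing_coef x = k.
Proof.
have t0 := twob_neq0.
exists (vec (k (if ads then 0 else 1) / (2 * b)) (k (if ads then 1 else 0) / (2 * b)),
  - k 2 *: Lstar R sig).
apply/funext => i; rewrite /killing_coef /eV0 /eV1 /eL /= !vecE so_coordZ so_coord_Lstar.
case: i => [[|[|[|//]]] il] /=; rewrite ?mulr1 ?opprK; case: ads => /=;
  rewrite 1?mulrC ?divfK //; congr k; exact: val_inj.
Qed.

Lemma killing_coef_isotropy (x : g) : even_isotropy x <-> killing_coef x 0 = 0 /\ killing_coef x 1 = 0.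
Proof.
have z (u : R) : 2 * b * u = 0 -> u = 0.
  by move=> /eqP; rewrite mulf_eq0 (negbTE twob_neq0) => /eqP.
split=> [/even_isotropyP[x0 x1]|].
  by rewrite /killing_coef /= x0 x1 !if_same !mulr0.
by rewrite /killing_coef /= => -[] /z h0 /z h1; apply/even_isotropyP; move: h0 h1; case: ads.
Qed.

Local Notation is_isometry_algebra_of :=
  (isometry_algebra_of_symmetric_surface br0 even_isotropy even_metric).

Lemma symmetric_surface_of_family :
  match sig, sB with
  | Sig02, _ => is_isometry_algebra_of (hyperbolic_plane radius) (- (8 * b ^+ 2))
  | Sig11, Bplus => is_isometry_algebra_of (de_sitter radius) (8 * b ^+ 2)
  | Sig11, Bminus =>
      is_isometry_algebra_of (anti_de_sitter radius) (- (8 * b ^+ 2))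
  end.
Proof.
have r0 := radius_neq0; have r2 := radius2.
(* The curvature -2 e1 / r^2 is -8 e1 b^2, positive for dS_2 alone. *)
pose e1 : R := if sig is Sig11 then (if sB is Bplus then -1 else 1) else 1.
have curv : (- 2 * e1 / radius ^+ 2) = if sig is Sig11 then
    (if sB is Bplus then 8 * b ^+ 2 else - (8 * b ^+ 2)) else - (8 * b ^+ 2).
  by rewrite r2 invrK /e1; case: sig; case: sB; ring.
pose circ := if sig is Sig11 then true else false.
(* On AdS_2 the bracket [P_0, P_1] has coefficient 4 b^2 although ang = -1; the exchange of P_0 and
   P_1 in [killing_coef] absorbs the sign. *)
have Hbr (x y : g) :
  [/\ killing_coef (br0 x y) 0 = - ang R circ * (killing_coef x 1 * killing_coef y 2 - killing_coef x 2 * killing_coef y 1),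
      killing_coef (br0 x y) 1 = killing_coef x 0 * killing_coef y 2 - killing_coef x 2 * killing_coef y 0
    & killing_coef (br0 x y) 2 = ang R circ * (killing_coef x 0 * killing_coef y 1 - killing_coef x 1 * killing_coef y 0)].
  rewrite /killing_coef !even_bracket_coord /= /even_curv /ads /circ /ang /sg.
  move: (eV0 x) (eV1 x) (eL x) (eV0 y) (eV1 y) (eL y) => ? ? ? ? ? ?.
  by split; case: (sig); case: (sB) => /=; ring.
have Hq (x y : g) : even_metric x y = radius ^+ 2 * e1 *
    (killing_coef x 1 * killing_coef y 1 + ang R circ * (killing_coef x 0 * killing_coef y 0)).
  rewrite even_metricE /killing_coef /= r2 /ads /circ /ang /sg /e1.
  move: (eV0 x) (eV1 x) (eV0 y) (eV1 y) => ? ? ? ?.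
  by case: (sig); case: (sB) => /=; field.
have e1M : e1 * e1 = 1 by rewrite /e1; case: (sig); case: (sB); ring.
(* What remains specific to a surface is the assignment of the ambient axes to a, b, c with the
   prescribed squares. *)
have main x y z i j k pts (K := diag3 x y z) : i != j -> j != k -> i != k ->
    K i i = - e1 -> K j j = ang R circ * e1 -> K k k = e1 ->
    (forall o, pts o <-> exists y0 y1 y2 : R,
      [/\ - y0 ^+ 2 + ang R circ * y1 ^+ 2 + y2 ^+ 2 = -1, ang R circ = 1 -> 0 < y0
        & o = emb radius (d i) (d j) (d k) y0 y1 y2]) ->
    is_isometry_algebra_of (Surface K pts) (- 2 * e1 / radius ^+ 2).
  move=> ij jk ik Ki Kj Kk ptsE.
  have K0 l l' : l != l' -> form K (d l) (d l') = 0 /\ form K (d l') (d l) = 0.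
    by move=> ll; rewrite !form_delta !diag3E [l' == l]eq_sym (negbTE ll).
  apply: (@symmetric_surface_model R circ e1 radius K (d i) (d j) (d k) pts
    e1M r0 _ _ _ _ _ _ ptsE g br0 even_isotropy even_metric killing_coef).
  - by rewrite form_delta.
  - by rewrite form_delta.
  - by rewrite form_delta.
  - exact: K0.
  - exact: K0.
  - exact: K0.
  - by move=> l u v m; exact: killing_coef_linear.
  - exact: killing_coef_injective.
  - exact: killing_coef_surjective.
  - exact: Hbr.
  - exact: killing_coef_isotropy.
  - exact: Hq.
move: main; rewrite curv /e1 /circ {e1M Hq Hbr curv e1 circ}.
case: (sig) (sB) => [] [] main.
- apply: (main _ _ _ 1 2 0); rewrite ?diag3E //=; try by rewrite mulr1n; ring.
  exact: de_sitter_points.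
- apply: (main _ _ _ 0 1 2); rewrite ?diag3E //=; try by rewrite mulr1n; ring.
  exact: anti_de_sitter_points.
- apply: (main _ _ _ 0 1 2); rewrite ?diag3E //=; try by rewrite mulr1n; ring.
  exact: hyperbolic_plane_points.
- apply: (main _ _ _ 0 1 2); rewrite ?diag3E //=; try by rewrite mulr1n; ring.
  exact: hyperbolic_plane_points.
Qed.

End ModelSurfaces.

Theorem mainTheorem2 (R : realType) (sig : signature) (sB : bsign) :
  (forall (beta : 'cV[R]_2 -> 'cV[R]_2 -> 'cV[R]_2)
          (gamma : 'cV[R]_2 -> 'cV[R]_2 -> so R sig),
     normalised_cocycle sig sB beta gamma ->
     integrable_cocycle sig sB beta gamma) /\
  (exists tilde : R -> superspace R sig -> superspace R sig -> superspace R sig,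
    (forall b : R,
      let br := tilde b in
      let P := P_ sig in
      let L := L_ sig in
      let vs := varsigma sig in
      [/\ filtered_deformation sig sB br,
          (exists beta gamma theta,
             [/\ normalised_cocycle sig sB beta gamma,
                 integrated_by sig sB beta gamma theta
               & br = deformation sig sB beta gamma theta]),
          (forall s, br L (inS s) = inS (2^-1 *: (GamStar sig *m s))) /\
          (forall mu, br L (P mu) = - vs *: \sum_nu eps mu nu *: P_up sig nu)
        & match sB with
          | Bplus =>
              [/\ forall mu nu,
                    br (P mu) (P nu) = (vs * 4 * b ^+ 2 * eps mu nu) *: L,
                  forall mu s,
                    br (P mu) (inS s) =
                    inS (b *: \sum_nu eps mu nu *: (Gam_up sig nu *m s))
                & forall s,
                    br (inS s) (inS s) =
                    \sum_mu kappa sig sB s s mu 0 *: P mu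
                    + (vs * 2 * b * bil sig sB s s) *: L]
          | Bminus =>
              [/\ forall mu nu,
                    br (P mu) (P nu) = (4 * b ^+ 2 * eps mu nu) *: L,
                  forall mu s, br (P mu) (inS s) = inS (b *: (Gam sig mu *m s))
                & forall s,
                    br (inS s) (inS s) =
                    \sum_mu kappa sig sB s s mu 0 *: P mu
                    - (vs * 2 * b * bil sig sB s (GamStar sig *m s)) *: L]
          end]) /\
    (forall b : R, b != 0 ->
      let br0 := even_bracket (tilde b) in
      let is_isometry_algebra_of M k :=
        isometry_algebra_of_symmetric_surface br0 even_isotropy even_metric M k
      in
      [/\ (forall U : {vspace superspace R sig},
             subsuperalgebra (tilde b) U ->
             (forall s, inS s \in U) -> U = fullv),
          metric_lie_pair br0 even_isotropy even_metric
        & match sig, sB with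
          | Sig02, _ =>
              exists2 r : R, 0 < r &
                is_isometry_algebra_of (hyperbolic_plane r) (- (8 * b ^+ 2))
          | Sig11, Bplus =>
              exists2 r : R, 0 < r &
                is_isometry_algebra_of (de_sitter r) (8 * b ^+ 2)
          | Sig11, Bminus =>
              exists2 r : R, 0 < r &
                is_isometry_algebra_of (anti_de_sitter r) (- (8 * b ^+ 2))
          end])).
Proof.
split=> [beta gamma /cocycle_classification[b [bE gE]]|].
  have -> : beta = beta_fam sig sB b by apply/funext => v; apply/funext => s.
  have -> : gamma = gamma_fam sig sB b by apply/funext => s; apply/funext => t.
  have I := family_integrated sig sB b.
  by split; [exact: integrated_annihilates I|exists (theta_fam sig sB b)].
exists (@tilde R sig sB); split=> b.
  split.
  - exact: filtered_deformation_tilde.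
  - exists (beta_fam sig sB b), (gamma_fam sig sB b), (theta_fam sig sB b).
    by split; [exact: family_cocycle|exact: family_integrated|].
  - exact: tilde_L.
  - exact: tilde_brackets.
move=> b0; split.
- by move=> U; exact: odd_part_generates.
- exact: metric_lie_pair_even.
- have := symmetric_surface_of_family b0 sig sB.
  by case: sig sB => [] [] h; exists (radius b) => //; exact: radius_gt0.
Qed.
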